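(* Let $\psi$ and $\chi$ be two MSO formulae over the signature $\{=\}\cup R_2$ such that $(\psi,\chi)$ is cw-size-independent. Then the problem $\psi$-under-$\chi$-dynamics is $\mathsf{P}$-hard under logspace reductions.
   Context: Fix a finite set $R_2$ of binary relation symbols and the signature $\{=\}\cup R_2$. An $R_2$-graph is a pair $G=(V,E)$ with $V$ finite and $E\subseteq R_2\times V\times V$; $|G|=|V|$. MSO formulae over this signature quantify over vertices and sets of vertices. Clique-width: for a finite color set $C$, a $C$-colored $R_2$-graph additionally has a coloring $\mathsf{Col}:V\to C$. Operations: $\mathsf{constant}^{\mathcal R}_c(v)$ (for $\mathcal R\subseteq R_2$, $c\in C$) creates a single vertex $v$ of color $c$ with loops $(r,v,v)$ for $r\in\mathcal R$; $\mathsf{recolor}_f(H)$ (for $f:C\to C$) replaces $\mathsf{Col}_H$ by $f\circ\mathsf{Col}_H$; $\mathsf{join}_M(H,H')$ (for $M\subseteq R_2\times\{\mathsf{left},\mathsf{right}\}\times C^2$) takes the disjoint union of $H,H'$ and, for each $u\in V(H)$, $v\in V(H')$ with colors $c_u,c_v$ and each $r\in R_2$, adds $(r,u,v)$ iff $(r,\mathsf{right},c_u,c_v)\in M$ and adds $(r,v,u)$ iff $(r,\mathsf{left},c_v,c_u)\in M$. A clique-decomposition is a binary tree of such operations (leaves constant, unary nodes recolor, binary nodes join); its width is the number of colors actually used by vertices at some node. The clique-width of an $R_2$-graph $G$ is the minimum width of a clique-decomposition constructing a graph isomorphic to $G$ (forgetting colors). $(\psi,\chi)$ is cw-size-independent if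 there is $k$ such that for infinitely many $n$ there exist $R_2$-graphs $G,G'$ with $n$ vertices and clique-width at most $k$ with $G\models\psi\wedge\chi$ and $G'\models\neg\psi\wedge\chi$. A succinct representation of an $R_2$-graph is a pair $(N,D)$ where $D$ is a Boolean circuit with $2\lceil\log_2 N\rceil$ inputs and $|R_2|$ outputs; it encodes the $R_2$-graph on vertex set $\{0,\dots,N-1\}$ in which $(r,x,y)$ is an arc iff the output of $D$ for $r$ on input $x,y$ is $1$. The problem $\psi$-under-$\chi$-dynamics: given $(N,D)$, with the promise that the encoded graph satisfies $\chi$, decide whether it satisfies $\psi$. *)

(* Defs.v *)
From mathcomp Require Import all_boot.

Set Implicit Arguments.
Unset Strict Implicit.
Unset Printing Implicit Defensive.

Record rgraph (R2 : finType) := RGraph {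
  vertex :> finType;
  arc : R2 -> rel vertex }.

Definition rgraph_iso (R2 : finType) (G H : rgraph R2) : Prop :=
  exists2 f : G -> H, bijective f &
    forall (r : R2) (u v : G), arc r (f u) (f v) = arc r u v.

(* [mso R2 m n]: formulae with [m] free vertex variables and [n] free set
   variables, as de Bruijn indices; a quantifier binds index 0. *)
Inductive mso (R2 : finType) : nat -> nat -> Type :=
| MEq m n (x y : 'I_m) : mso R2 m n
| MRel m n (r : R2) (x y : 'I_m) : mso R2 m n
| MIn m n (x : 'I_m) (X : 'I_n) : mso R2 m n
| MNot m n (phi : mso R2 m n) : mso R2 m n
| MAnd m n (phi1 phi2 : mso R2 m n) : mso R2 m n
| MOr m n (phi1 phi2 : mso R2 m n) : mso R2 m n
| MExV m n (phi : mso R2 m.+1 n) : mso R2 m n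
| MAllV m n (phi : mso R2 m.+1 n) : mso R2 m n
| MExS m n (phi : mso R2 m n.+1) : mso R2 m n
| MAllS m n (phi : mso R2 m n.+1) : mso R2 m n.

Fixpoint sat (R2 : finType) (G : rgraph R2) m n (phi : mso R2 m n) :
    m.-tuple G -> n.-tuple {set G} -> Prop :=
  match phi with
  | MEq _ _ x y => fun e _ => tnth e x = tnth e y
  | MRel _ _ r x y => fun e _ => arc r (tnth e x) (tnth e y)
  | MIn _ _ x X => fun e E => tnth e x \in tnth E X
  | MNot _ _ phi => fun e E => ~ sat phi e E
  | MAnd _ _ phi1 phi2 => fun e E => sat phi1 e E /\ sat phi2 e E
  | MOr _ _ phi1 phi2 => fun e E => sat phi1 e E \/ sat phi2 e E
  | MExV _ _ phi => fun e E => exists v : G, sat phi [tuple of v :: e] E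
  | MAllV _ _ phi => fun e E => forall v : G, sat phi [tuple of v :: e] E
  | MExS _ _ phi => fun e E =>
      exists A : {set G}, sat phi e [tuple of A :: E]
  | MAllS _ _ phi => fun e E =>
      forall A : {set G}, sat phi e [tuple of A :: E]
  end.

Notation sentence R2 := (mso R2 0 0).

Definition models (R2 : finType) (G : rgraph R2) (phi : sentence R2) : Prop :=
  @sat R2 G 0 0 phi [tuple] [tuple].

Record cgraph (R2 C : finType) := CGraph {
  uncolored :> rgraph R2;
  color : uncolored -> C }.

Inductive side := SLeft | SRight.

Inductive cwdec (R2 C : finType) :=
| Constant (rs : {set R2}) (c : C)
| Recolor (f : C -> C) (t : cwdec R2 C)
| Join (M : pred (R2 * side * (C * C))) (t1 t2 : cwdec R2 C).

Section CliqueWidth.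
Variables R2 C : finType.

Definition constant_graph (rs : {set R2}) (c : C) : cgraph R2 C :=
  @CGraph R2 C (@RGraph R2 unit (fun r _ _ => r \in rs)) (fun _ => c).

Definition recolor_graph (f : C -> C) (H : cgraph R2 C) : cgraph R2 C :=
  @CGraph R2 C H (fun v => f (color v)).

Definition join_arc (M : pred (R2 * side * (C * C))) (H H' : cgraph R2 C)
    (r : R2) (a b : H + H') : bool :=
  match a, b with
  | inl u, inl u' => arc r u u'
  | inr v, inr v' => arc r v v'
  | inl u, inr v => M (r, SRight, (color u, color v))
  | inr v, inl u => M (r, SLeft, (color v, color u))
  end.

Definition join_graph (M : pred (R2 * side * (C * C))) (H H' : cgraph R2 C) :
    cgraph R2 C :=
  @CGraph R2 C (@RGraph R2 (H + H')%type (@join_arc M H H'))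
    (fun a => match a with inl u => color u | inr v => color v end).

Fixpoint build (t : cwdec R2 C) : cgraph R2 C :=
  match t with
  | Constant rs c => constant_graph rs c
  | Recolor f t => recolor_graph f (build t)
  | Join M t1 t2 => join_graph M (build t1) (build t2)
  end.

Definition colors_at (t : cwdec R2 C) : {set C} :=
  [set @color R2 C (build t) v | v in [set: build t]].

Fixpoint used_colors (t : cwdec R2 C) : {set C} :=
  colors_at t :|: match t with
                  | Constant _ _ => set0
                  | Recolor _ t => used_colors t
                  | Join _ t1 t2 => used_colors t1 :|: used_colors t2
                  end.

Definition width (t : cwdec R2 C) : nat := #|used_colors t|.

End CliqueWidth.

Definition is_cliquewidth (R2 : finType) (G : rgraph R2) (w : nat) : Prop :=
  (exists (C : finType) (t : cwdec R2 C),
     rgraph_iso G (build t) /\ width t = w) /\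
  (forall (C : finType) (t : cwdec R2 C),
     rgraph_iso G (build t) -> w <= width t).

Definition cliquewidth_le (R2 : finType) (G : rgraph R2) (k : nat) : Prop :=
  exists2 w, is_cliquewidth G w & w <= k.

Definition cw_size_independent (R2 : finType) (psi chi : sentence R2) : Prop :=
  exists k : nat, forall n0 : nat, exists2 n, n0 <= n &
    exists G G' : rgraph R2,
      [/\ #|G| = n, #|G'| = n, cliquewidth_le G k & cliquewidth_le G' k] /\
      [/\ models G psi, models G chi, ~ models G' psi & models G' chi].

(* Straight-line circuits: gate [k] refers to gates of index [< k]. *)
Inductive gate :=
| Input of nat
| Const of bool
| Not of nat
| And of nat & nat
| Or of nat & nat.

Record circuit := Circuit { gates : seq gate; outputs : seq nat }.

Definition gate_val (inp vals : seq bool) (g : gate) : bool :=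
  match g with
  | Input i => nth false inp i
  | Const b => b
  | Not i => ~~ nth false vals i
  | And i j => nth false vals i && nth false vals j
  | Or i j => nth false vals i || nth false vals j
  end.

Definition gate_vals (gs : seq gate) (inp : seq bool) : seq bool :=
  foldl (fun vals g => rcons vals (gate_val inp vals g)) [::] gs.

Definition circuit_eval (D : circuit) (inp : seq bool) : seq bool :=
  [seq nth false (gate_vals (gates D) inp) o | o <- outputs D].

Definition gate_wf (nin k : nat) (g : gate) : bool :=
  match g with
  | Input i => i < nin
  | Const _ => true
  | Not i => i < k
  | And i j | Or i j => (i < k) && (j < k)
  end.

Definition circuit_wf (nin nout : nat) (D : circuit) : Prop :=
  [/\ forall k, k < size (gates D) ->
        gate_wf nin k (nth (Const false) (gates D) k),
      all (fun o => o < size (gates D)) (outputs D)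
    & size (outputs D) = nout].

(* The [w] low-order bits of [x], least significant first. *)
Definition bits (w x : nat) : seq bool :=
  mkseq (fun i => odd (x %/ 2 ^ i)) w.

(* [up_log 2 N] is the ceiling of the base-2 logarithm of [N]. *)
Definition succinct_rep (R2 : finType) (N : nat) (D : circuit) : Prop :=
  0 < N /\ circuit_wf (2 * up_log 2 N) #|R2| D.

(* The outputs of [D] are listed in the order of [enum R2]. *)
Definition encoded_graph (R2 : finType) (N : nat) (D : circuit) : rgraph R2 :=
  @RGraph R2 'I_N (fun r x y =>
    nth false (circuit_eval D (bits (up_log 2 N) x ++ bits (up_log 2 N) y))
      (enum_rank r)).

Definition enc_seq (T : Type) (enc : T -> seq bool) (s : seq T) : seq bool :=
  flatten [seq true :: enc a | a <- s] ++ [:: false].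

(* Self-delimiting binary; [up_log 2 n.+1] is the binary length of [n]. *)
Definition enc_nat (n : nat) : seq bool :=
  enc_seq (fun b => [:: b]) (bits (up_log 2 n.+1) n).
Arguments enc_nat : simpl never.

Definition enc_gate (g : gate) : seq bool :=
  match g with
  | Input i => [:: false; false; false] ++ enc_nat i
  | Const b => [:: false; false; true; b]
  | Not i => [:: false; true] ++ enc_nat i
  | And i j => [:: true; false] ++ enc_nat i ++ enc_nat j
  | Or i j => [:: true; true] ++ enc_nat i ++ enc_nat j
  end.

Definition encode (N : nat) (D : circuit) : seq bool :=
  enc_nat N ++ enc_seq enc_gate (gates D) ++ enc_seq enc_nat (outputs D).

Definition prefix_code (T : Type) (enc : T -> seq bool) : Prop :=
  forall a b s t, enc a ++ s = enc b ++ t -> a = b /\ s = t.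

Lemma enc_seq_prefix (T : Type) (enc : T -> seq bool) :
  prefix_code enc -> prefix_code (enc_seq enc).
Proof.
move=> encP; elim=> [|a u IHu] [|b v] s t //=.
  by case.
rewrite /enc_seq /= -!catA => -[] /encP[-> E].
by have [|-> ->] := IHu v s t; rewrite /enc_seq -?catA.
Qed.

Lemma bits_inj n m :
  bits (up_log 2 n.+1) n = bits (up_log 2 m.+1) m -> n = m.
Proof.
have low w x y : x < 2 ^ w -> y < 2 ^ w -> bits w x = bits w y -> x = y.
  rewrite /bits; elim: w x y => [|w IHw] x y.
    by rewrite expn0 !ltnS !leqn0 => /eqP-> /eqP->.
  move=> lx ly; rewrite /mkseq /= expn0 !divn1 => -[e0 E].
  have half z : z < 2 ^ w.+1 -> z %/ 2 < 2 ^ w.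
    by rewrite ltn_divLR // mulnC -expnS.
  rewrite -[x]odd_double_half -[y]odd_double_half e0; congr (_ + _.*2).
  rewrite -!divn2; apply: IHw; rewrite ?half //.
  move: E; rewrite (iotaDl 1 0) -!map_comp => /(_ =P _)/eqP E.
  by rewrite /mkseq; under eq_map => i do rewrite -divnMA -expnS;
     under [RHS]eq_map => i do rewrite -divnMA -expnS.
move=> E; have /eqP := congr1 size E; rewrite !size_mkseq => /eqP ew.
by move: E; rewrite -ew; apply: low; [|rewrite ew]; exact: up_logP.
Qed.

Lemma enc_nat_prefix : prefix_code enc_nat.
Proof.
move=> n m s t /(enc_seq_prefix _)[|/bits_inj-> ->] //.
by move=> a b u v /= [-> ->].
Qed.

Lemma enc_gate_prefix : prefix_code enc_gate.
Proof.
case=> [i|b|i|i j|i j] [i'|b'|i'|i' j'|i' j'] s t //=.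
- by case=> /enc_nat_prefix[-> ->].
- by case=> -> ->.
- by case=> /enc_nat_prefix[-> ->].
- rewrite -![(_ ++ enc_nat _) ++ _]catA.
  by case=> /enc_nat_prefix[-> /enc_nat_prefix[-> ->]].
- rewrite -![(_ ++ enc_nat _) ++ _]catA.
  by case=> /enc_nat_prefix[-> /enc_nat_prefix[-> ->]].
Qed.

Lemma encode_inj N D N' D' : encode N D = encode N' D' -> N = N' /\ D = D'.
Proof.
case: D D' => [gs os] [gs' os']; rewrite /encode /=.
case/enc_nat_prefix=> -> /(enc_seq_prefix enc_gate_prefix)[-> E].
have [|-> _ //] := @enc_seq_prefix _ _ enc_nat_prefix os os' [::] [::].
by rewrite !cats0.
Qed.

Inductive move := MLeft | MStay | MRight.

(* A two-way infinite tape with blank [None]: the visited cells to the left of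
   the head (nearest first), the scanned cell, and those to its right. *)
Record tape (A : Type) := Tape {
  tleft : seq (option A);
  tcur : option A;
  tright : seq (option A) }.

Definition blank_tape (A : Type) : tape A := @Tape A [::] None [::].

Definition tape_size (A : Type) (tp : tape A) : nat :=
  (size (tleft tp) + size (tright tp)).+1.

Definition tape_act (A : Type) (a : option A) (m : move) (tp : tape A) :
    tape A :=
  match m with
  | MLeft => Tape (behead (tleft tp)) (head None (tleft tp)) (a :: tright tp)
  | MStay => Tape (tleft tp) a (tright tp)
  | MRight => Tape (a :: tleft tp) (head None (tright tp)) (behead (tright tp))
  end.

(* The tape alphabet is [option (bool + dsym)]: input bits, extra symbols and
   the blank; [ddelta] returns [None] when the machine halts. *)
Record decider := Decider {
  dstate : finType;
  dsym : finType;
  dstart : dstate;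
  ddelta : dstate -> option (bool + dsym) ->
           option (dstate * option (bool + dsym) * move);
  daccept : pred dstate }.

Section Decider.
Variable M : decider.

Definition dconf : Type := dstate M * tape (bool + dsym M).

Definition dinit (x : seq bool) : dconf :=
  let s := [seq Some (inl b) | b <- x] in
  (dstart M, Tape [::] (head None s) (behead s)).

Definition dstep (c : dconf) : option dconf :=
  if ddelta c.1 (tcur c.2) is Some (q, a, m)
  then Some (q, tape_act a m c.2) else None.

Definition drun (t : nat) (c : dconf) : dconf :=
  iter t (fun c => odflt c (dstep c)) c.

End Decider.

Definition language := seq bool -> Prop.

Definition in_P (L : language) : Prop :=
  exists (M : decider) (c d : nat), forall x : seq bool,
    let cf := drun (c * size x ^ d + c) (dinit M x) in
    dstep cf = None /\ (daccept cf.1 <-> L x).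

Inductive insym := LeftEnd | InBit of bool | RightEnd.

Definition read_input (x : seq bool) (p : nat) : insym :=
  if p is p'.+1 then
    if onth x p' is Some b then InBit b else RightEnd
  else LeftEnd.

(* The input head is confined to the positions [0 .. (size x).+1], whose
   extremities are the end markers. *)
Definition input_move (x : seq bool) (m : move) (p : nat) : nat :=
  match m with
  | MLeft => p.-1
  | MStay => p
  | MRight => minn p.+1 (size x).+1
  end.

(* A machine with a read-only input tape, [tnum] work tapes and a write-only
   output tape, on which at most one bit is appended at each step. *)
Record transducer := Transducer {
  tstate : finType;
  tsym : finType;
  tnum : nat;
  tstart : tstate;
  tdelta : tstate -> insym -> tnum.-tuple (option tsym) ->
           option (tstate * move * tnum.-tuple (option tsym * move) *
                   option bool) }.

Section Transducer.
Variable M : transducer.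

Record tconf := TConf {
  tcstate : tstate M;
  tcinpos : nat;
  tcwork : (tnum M).-tuple (tape (tsym M));
  tcout : seq bool }.

Definition tinit : tconf :=
  TConf (tstart M) 0 [tuple blank_tape (tsym M) | _ < tnum M] [::].

Definition tstep (x : seq bool) (c : tconf) : option tconf :=
  if tdelta (tcstate c) (read_input x (tcinpos c))
       (map_tuple (@tcur (tsym M)) (tcwork c)) is Some (q, m, acts, o)
  then Some (TConf q (input_move x m (tcinpos c))
         [tuple tape_act (tnth acts i).1 (tnth acts i).2 (tnth (tcwork c) i)
           | i < tnum M]
         (oapp (rcons (tcout c)) (tcout c) o))
  else None.

Definition trun (x : seq bool) (t : nat) : tconf :=
  iter t (fun c => odflt c (tstep x c)) tinit.

End Transducer.

(* Space counts the visited cells of the work tapes only. *)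
Definition logspace (f : seq bool -> seq bool) : Prop :=
  exists (M : transducer) (c : nat), forall x : seq bool,
    (exists t, tstep x (trun M x t) = None /\ tcout (trun M x t) = f x) /\
    (forall t, \sum_(tp <- tcwork (trun M x t)) tape_size tp
                 <= c * trunc_log 2 (size x) + c).

Record promise_problem := PromiseProblem {
  yes_instance : seq bool -> Prop;
  no_instance : seq bool -> Prop }.

Definition P_hard (A : promise_problem) : Prop :=
  forall L : language, in_P L ->
    exists2 f : seq bool -> seq bool, logspace f &
      forall x, (L x -> yes_instance A (f x)) /\
                (~ L x -> no_instance A (f x)).

Definition under_dynamics (R2 : finType) (psi chi : sentence R2) :
    promise_problem :=
  let promised s (concl : rgraph R2 -> Prop) :=
    exists N D, [/\ s = encode N D, succinct_rep R2 N D,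
      models (encoded_graph R2 N D) chi & concl (encoded_graph R2 N D)] in
  {| yes_instance := fun s => promised s (fun G => models G psi);
     no_instance := fun s => promised s (fun G => ~ models G psi) |}.

(* Main.v *)
Require Import Defs.
From mathcomp Require Import all_boot.
From mathcomp Require Import zify.

Set Implicit Arguments.
Unset Strict Implicit.
Unset Printing Implicit Defensive.

(* A succinct representation may use an arbitrarily large circuit for a graph of
   fixed size, so a single pair of graphs [G], [G'] on the same [n] vertices,
   both models of [chi] and only the first one of [psi], is enough: the input of
   a polynomial-time machine is mapped to [n] and to a circuit which first
   computes whether the machine accepts, ignoring its own inputs, and then
   outputs the arcs of [G] or those of [G'] accordingly.

   The acceptance bit is computed by a tableau unrolled along a helix: the cells
   of all configurations are numbered consecutively, and cell [i] is a fixed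
   function of cells [i - 1], [i - P - 1], [i - P] and [i - P + 1], where [P] is
   the length of a row. Hence, apart from those of the first row, all cells are
   computed by one block of gates, shifted, and a transducer can print the
   circuit with two binary registers, holding the positions of cells [i - 1] and
   [i - P - 1], and a loop counter. The loops run for [b ^ l] steps, where [l] is
   the binary length of the input size, by counting in base [b] on [l] tape
   cells. *)

(** * Control fragments of logspace transducers *)

(** Gluing the rows into a helix gives border cells neighbours from another row. This is harmless
    because each row has, on both sides, a margin longer than the running time, so that no border
    cell ever holds the head. Neither the exact running time nor the place where the machine halts
    has to be known: a halted configuration repeats itself, and a mark carried along the helix
    records that an accepting cell has occurred, so any overestimate of the number of cells yields
    the same last mark. Blocks are uniform because all cells take the same number of gates: cells
    are one-hot, each bit is a Shannon expansion whose size depends only on the number of variables,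
    and constant cells are padded to that size. Gate numbers then grow by a fixed amount from cell
    to cell, and every reference is a register plus a constant. With [l] the binary length of
    [n + 1], [2 ^ l] exceeds [n + 1], so [(2 ^ e) ^ l] dominates a given polynomial once [e] is
    large enough; the base [2 ^ e] is a constant of the reduction and fits into the tape
    alphabet. *)

Section Fragments.
Variables (Sy : finType) (K : nat).

Record memory := Memory {
  mpos : nat;
  mtapes : K.-tuple (tape Sy);
  mout : seq bool }.

Definition acts := K.-tuple (option Sy * move).

(* A control fragment leaves through one of two exits, labelled by a Boolean;
   the exiting transition still acts on the memory. *)
Record frag := Frag {
  fstate : finType;
  fentry : fstate;
  fdelta : fstate -> insym -> K.-tuple (option Sy) ->
           (fstate + bool) * move * acts * option bool }.

Definition mact (x : seq bool) (m : memory) (mv : move) (a : acts)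
    (o : option bool) : memory :=
  Memory (input_move x mv (mpos m))
      [tuple tape_act (tnth a i).1 (tnth a i).2 (tnth (mtapes m) i) | i < K]
      (oapp (rcons (mout m)) (mout m) o).

Definition fview (x : seq bool) (F : frag) (q : fstate F) (m : memory) :=
  fdelta q (read_input x (mpos m)) (map_tuple (@tcur Sy) (mtapes m)).

(** Being inductive, it only admits finite runs: a derivation of [exec] includes termination. *)
Inductive runs (x : seq bool) (F : frag) :
    fstate F -> memory -> bool -> memory -> Prop :=
| RunsExit q m b mv a o :
    fview x q m = (inr b, mv, a, o) -> runs x q m b (mact x m mv a o)
| RunsStep q q' m b m' mv a o :
    fview x q m = (inl q', mv, a, o) -> runs x q' (mact x m mv a o) b m' ->
    runs x q m b m'.

Definition exec x F := @runs x F (fentry F).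

Definition keep (cs : K.-tuple (option Sy)) : acts :=
  [tuple (tnth cs i, MStay) | i < K].

Definition act_on (k : 'I_K) (a : option Sy) (mv : move)
    (cs : K.-tuple (option Sy)) : acts :=
  [tuple if i == k then (a, mv) else (tnth cs i, MStay) | i < K].

Definition set_tape (k : 'I_K) (tp : tape Sy) (ts : K.-tuple (tape Sy)) :=
  [tuple if i == k then tp else tnth ts i | i < K].

Lemma tape_act_stay (tp : tape Sy) : tape_act (tcur tp) MStay tp = tp.
Proof. by case: tp. Qed.

Lemma mact_keep x m mv o :
  mact x m mv (keep (map_tuple (@tcur Sy) (mtapes m))) o =
  Memory (input_move x mv (mpos m)) (mtapes m) (oapp (rcons (mout m)) (mout m) o).
Proof.
congr Memory; apply: eq_from_tnth => i.
by rewrite !tnth_mktuple tnth_map tape_act_stay.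
Qed.

Lemma mact_on x m k a mv o :
  mact x m MStay (act_on k a mv (map_tuple (@tcur Sy) (mtapes m))) o =
  Memory (mpos m) (set_tape k (tape_act a mv (tnth (mtapes m) k)) (mtapes m))
      (oapp (rcons (mout m)) (mout m) o).
Proof.
congr Memory; apply: eq_from_tnth => i; rewrite !tnth_mktuple.
by case: eqP => [->|_]; last rewrite [_.2]/= [_.1]/= tnth_map tape_act_stay.
Qed.

Lemma tnth_set_tape k tp ts : tnth (set_tape k tp ts) k = tp.
Proof. by rewrite tnth_mktuple eqxx. Qed.

Lemma set_set_tape k tp tp' ts :
  set_tape k tp (set_tape k tp' ts) = set_tape k tp ts.
Proof.
by apply: eq_from_tnth => i; rewrite !tnth_mktuple; case: eqP.
Qed.

Lemma set_tape_id k ts : set_tape k (tnth ts k) ts = ts.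
Proof. by apply: eq_from_tnth => i; rewrite !tnth_mktuple; case: eqP => [->|]. Qed.

Definition emit (o : option bool) : frag :=
  @Frag unit tt (fun _ _ cs => (inr true, MStay, keep cs, o)).

Definition rewind : frag :=
  @Frag unit tt (fun _ i cs =>
    if i is LeftEnd then (inr true, MRight, keep cs, None)
    else (inl tt, MLeft, keep cs, None)).

Definition seqf (F G : frag) : frag :=
  @Frag (fstate F + fstate G)%type (inl (fentry F)) (fun s i cs =>
    match s with
    | inl q => let: (r, mv, a, o) := fdelta q i cs in
        (inl (if r is inl q' then inl q' else inr (fentry G)), mv, a, o)
    | inr q => let: (r, mv, a, o) := fdelta q i cs in
        (match r with inl q' => inl (inr q') | inr b => inr b end, mv, a, o)
    end).

Definition dowhile (F : frag) : frag :=
  @Frag (fstate F) (fentry F) (fun q i cs =>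
    let: (r, mv, a, o) := fdelta q i cs in
    (match r with
     | inl q' => inl q'
     | inr b => if b then inl (fentry F) else inr false
     end, mv, a, o)).

Definition bit_of_insym (i : insym) : option bool :=
  if i is InBit b then Some b else None.

(** The bit read is remembered by the choice of a branch, whose state space depends on it, whence
    [existT]. The exit tells whether a bit was read and overrides that of the branch, so
    [dowhile (casef F)] scans the input up to its right end. *)
Definition casef (F : option bool -> frag) : frag :=
  @Frag (option {o : option bool & fstate (F o)}) None (fun s i cs =>
    match s with
    | None => let o := bit_of_insym i in
        (inl (Some (existT _ o (fentry (F o)))), MRight, keep cs, None)
    | Some (existT o q) => let: (r, mv, a, out) := fdelta q i cs in
        (match r with
         | inl q' => inl (Some (existT _ o q'))
         | inr _ => inr (isSome o)
         end, mv, a, out)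
    end).

Lemma exec_emit x o m :
  exec x (emit o) m true
    (Memory (mpos m) (mtapes m) (oapp (rcons (mout m)) (mout m) o)).
Proof. by rewrite -(mact_keep x m MStay); apply: RunsExit. Qed.

Lemma exec_rewind x m : mpos m <= (size x).+1 ->
  exec x rewind m true (Memory 1 (mtapes m) (mout m)).
Proof.
case: m => p ts out /=; elim: p => [|p IHp] lep.
  have -> : 1 = input_move x MRight 0 by rewrite /= minnE; lia.
  rewrite -[ts]/(mtapes (Memory 0 ts out)) -[out]/(oapp (rcons out) out None).
  by rewrite -(mact_keep x (Memory 0 ts out)); apply: RunsExit.
apply: (@RunsStep _ rewind _ tt _ _ _ MLeft
          (keep (map_tuple (@tcur Sy) ts)) None).
  by rewrite /fview /=; case: onth.
by rewrite (mact_keep x (Memory p.+1 ts out)) /=; apply: IHp; apply: ltnW.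
Qed.

Lemma exec_seqf x F G m b m1 b' m2 :
  exec x F m b m1 -> exec x G m1 b' m2 -> exec x (seqf F G) m b' m2.
Proof.
rewrite /exec => RF RG; rewrite [fentry (seqf F G)]/=.
elim: RF RG => {m b m1} [q m b mv a o|q q' m b m1 mv a o] E.
  move=> RG; apply: RunsStep; first by rewrite /fview /= -/(fview x q m) E.
  elim: RG => {E q} [q m3 b3 mv3 a3 o3 E|q q' m3 b3 m4 mv3 a3 o3 E _].
    by apply: RunsExit; rewrite /fview /= -/(fview x q m3) E.
  by apply: RunsStep; rewrite /fview /= -/(fview x q m3) E.
move=> _ IH RG; apply: RunsStep (IH RG).
by rewrite /fview /= -/(fview x q m) E.
Qed.

Lemma exec_dowhile_last x F m m1 :
  exec x F m false m1 -> exec x (dowhile F) m false m1.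
Proof.
rewrite /exec [fentry (dowhile F)]/=; move Eb: false => b RF.
elim: RF Eb => {m b m1} [q m b mv a o|q q' m b m1 mv a o] E.
  by move=> Eb; apply: RunsExit; rewrite /fview /= -/(fview x q m) E -Eb.
move=> _ IH Eb; apply: RunsStep (IH Eb).
by rewrite /fview /= -/(fview x q m) E.
Qed.

Lemma exec_dowhile_again x F m m1 b' m2 :
  exec x F m true m1 -> exec x (dowhile F) m1 b' m2 ->
  exec x (dowhile F) m b' m2.
Proof.
rewrite /exec {2}[fentry (dowhile F)]/=; move Eb: true => b RF.
elim: RF Eb => {m b m1} [q m b mv a o|q q' m b m1 mv a o] E.
  by move=> Eb; apply: RunsStep; rewrite /fview /= -/(fview x q m) E -Eb.
move=> _ IH Eb RG; apply: RunsStep (IH Eb RG).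
by rewrite /fview /= -/(fview x q m) E.
Qed.

Lemma exec_casef x F m b m' :
  let o := bit_of_insym (read_input x (mpos m)) in
  exec x (F o) (Memory (input_move x MRight (mpos m)) (mtapes m) (mout m)) b m' ->
  exec x (casef F) m (isSome o) m'.
Proof.
move=> o RF; apply: (@RunsStep _ _ _
  (Some (existT _ o (fentry (F o))) : fstate (casef F))); first by [].
rewrite mact_keep /=; rewrite /exec in RF.
move: o (Memory _ _ _) RF => o m1 RF.
elim: RF => {m m1 b m'} [q m b mv a o'|q q' m b m1 mv a o'] E.
  by apply: RunsExit; rewrite /fview /= -/(fview x q m) E.
by move=> _; apply: RunsStep; rewrite /fview /= -/(fview x q m) E.
Qed.

(** A transducer halts on an undefined transition, whereas the exit of a fragment still acts on the
    memory; the extra state [None] is where this last action leads. *)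
Definition transducer_of (F : frag) : transducer :=
  @Transducer (option (fstate F)) Sy K (Some (fentry F)) (fun s i cs =>
    if s is Some q then
      let: (r, mv, a, o) := fdelta q i cs in
      Some (if r is inl q' then Some q' else None, mv, a, o)
    else None).

Definition memory0 : memory := Memory 0 [tuple blank_tape Sy | _ < K] [::].

Lemma exec_transducer x F b m : exec x F memory0 b m ->
  exists t, [/\ tstep x (trun (transducer_of F) x t) = None,
                tcout (trun (transducer_of F) x t) = mout m &
                tcwork (trun (transducer_of F) x t) = mtapes m].
Proof.
pose conf q (m : memory) : tconf (transducer_of F) :=
  @TConf (transducer_of F) q (mpos m) (mtapes m) (mout m).
suff run q m0 : runs x q m0 b m -> exists t,
    iter t (fun c => odflt c (tstep x c)) (conf (Some q) m0) = conf None m.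
  by case/run=> t E; exists t; rewrite /trun -[tinit _]/(conf (Some (fentry F)) memory0) E.
elim=> {m0 b m q} [q m b mv a o|q q' m b m' mv a o] E.
  by exists 1; rewrite /= /tstep /= -/(fview x q m) E.
by move=> _ [t Et]; exists t.+1; rewrite iterSr {2}/tstep /= -/(fview x q m) E.
Qed.

Lemma tape_size_act a mv (tp : tape Sy) :
  tape_size tp <= tape_size (tape_act a mv tp).
Proof.
by case: tp mv => [[|l ls] c [|r rs]] [] //=; rewrite /tape_size /=; lia.
Qed.

End Fragments.

(** Visited cells are never dropped, so the space of a halting run can be read off its final
    configuration. *)
Lemma leq_sum_work (M : transducer) x t u : t <= u ->
  \sum_(tp <- tcwork (trun M x t)) tape_size tp <=
  \sum_(tp <- tcwork (trun M x u)) tape_size tp.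
Proof.
move/subnK=> <-; elim: (u - t) => //= v IHv; apply: leq_trans IHv _.
rewrite /trun iterD /= -iterD; move: (iter _ _ _) => c.
rewrite /tstep; case: tdelta => //= -[[[q mv] a] o] /=.
rewrite [leqRHS]big_map big_enum big_tuple; apply: leq_sum => i _.
exact: tape_size_act.
Qed.

(** * Passes over a work tape *)

Section Sweep.
Variables (Sy : finType) (K : nat) (C : finType).
Variable g : C -> option Sy -> option (C * option Sy * option bool).

Definition print_bit (o : option bool) : seq bool :=
  if o is Some b then [:: true; b] else [::].

(** The effect of one pass on a tape content, abstracted from machine steps. [SweepStay] prints
    beyond the end of the content without lengthening it, as when a sum is printed but not
    stored. *)
Inductive sweeps : C -> seq Sy -> seq Sy -> seq bool -> C -> Prop :=
| SweepStop c : g c None = None -> sweeps c [::] [::] [::] c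
| SweepStep c s c' d o s' out cf : g c (ohead s) = Some (c', Some d, o) ->
    sweeps c' (behead s) s' out cf ->
    sweeps c s (d :: s') (print_bit o ++ out) cf
| SweepStay c c' o s' out cf : g c None = Some (c', None, o) ->
    sweeps c' [::] s' out cf -> sweeps c [::] s' (print_bit o ++ out) cf.

Variables (flag : C -> bool) (c0 : C) (k : 'I_K).

(* From the blank left of its content, the head passes over the content of
   tape [k], then returns. Every scanned cell takes two steps, since printing
   the bit [b] outputs [true; b]. *)
Definition sweep : frag Sy K :=
  @Frag Sy K (option (C * bool) + bool)%type (inl None) (fun s _ cs =>
    let cur := tnth cs k in
    match s with
    | inl None =>
        (inl (inl (Some (c0, false))), MStay, act_on k cur MRight cs, None)
    | inl (Some (c, second)) =>
        match g c cur with
        | None => (inl (inr (flag c)), MStay, act_on k cur MLeft cs, None)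
        | Some (c', w, o) =>
            if second then
              (inl (inl (Some (c', false))), MStay,
               if w is Some _ then act_on k w MRight cs
               else act_on k cur MStay cs, o)
            else (inl (inl (Some (c, true))), MStay, act_on k cur MStay cs,
                  omap (fun=> true) o)
        end
    | inr f => if cur is Some _
        then (inl (inr f), MStay, act_on k cur MLeft cs, None)
        else (inr f, MStay, act_on k cur MStay cs, None)
    end).

(* The head stands on the blank left of the content; at most one further blank
   has been visited, at the right end. *)
Definition holds (tp : tape Sy) (s : seq Sy) : Prop :=
  exists e : bool, tp = Tape [::] None (map Some s ++ nseq e None).

Let scanned (l : seq Sy) (r : seq (option Sy)) : tape Sy :=
  Tape (map Some l ++ [:: None]) (head None r) (behead r).

Let at_tape p ts o tp : memory Sy K := Memory p (set_tape k tp ts) o.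

Lemma map_set_tape tp (ts : K.-tuple (tape Sy)) :
  tnth (map_tuple (@tcur Sy) (set_tape k tp ts)) k = tcur tp.
Proof. by rewrite tnth_map tnth_set_tape. Qed.

Lemma mact_at x p ts o tp a mv out :
  mact x (at_tape p ts o tp) MStay
    (act_on k a mv (map_tuple (@tcur Sy) (set_tape k tp ts))) out =
  at_tape p ts (oapp (rcons o) o out) (tape_act a mv tp).
Proof. by rewrite mact_on /= tnth_set_tape set_set_tape. Qed.

Lemma runs_return x p ts o f l r :
  @runs _ _ x sweep (inr f)
    (at_tape p ts o
       (Tape (behead (map Some l ++ [:: None]))
          (head None (map Some l ++ [:: None])) r)) f
    (at_tape p ts o (Tape [::] None (map Some (rev l) ++ r))).
Proof.
elim: l r => [|d l IHl] r /=.
  have := @RunsExit _ _ x sweep (inr f) (at_tape p ts o (Tape [::] None r)) f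
    MStay _ None.
  rewrite {1}/fview /= map_set_tape /= => /(_ _ erefl).
  by rewrite -{2}[None]/(tcur (Tape [::] None r)) mact_at.
apply: RunsStep.
  by rewrite /fview /= map_set_tape /=.
rewrite mact_at /= rev_cons map_rcons cat_rcons; exact: IHl.
Qed.

Lemma runs_scan x c s s' out cf : sweeps c s s' out cf ->
  forall l (e : bool) p ts o, exists e' : bool,
    @runs _ _ x sweep (inl (Some (c, false)))
      (at_tape p ts o (scanned l (map Some s ++ nseq e None))) (flag cf)
      (at_tape p ts (o ++ out)
         (Tape [::] None (map Some (rev l ++ s') ++ nseq e' None))).
Proof.
elim=> {c s s' out cf}.
(* The blank on which the scan stops has now been visited and remains at the right end. *)
- move=> c gc l e p ts o; exists true; rewrite cats0.
  have Eh : head None (map Some [::] ++ nseq e None) = None :> option Sy.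
    by case: e.
  apply: RunsStep; first by rewrite /fview /= map_set_tape /= Eh gc.
  rewrite mact_at /= cats0.
  by case: e {Eh}; apply: (runs_return x p ts o (flag c) l [:: None]).
- move=> c s c' d o' s' out cf gc _ IH l e p ts o.
  have [e'' Ee] : exists e'' : bool, behead (map Some s ++ nseq e None) =
      map Some (behead s) ++ nseq e'' None.
    by case: s e {gc IH} => [|? s] [] /=; [exists false|exists false|exists true|exists false].
  have Eh : head None (map Some s ++ nseq e None) = ohead s.
    by case: s e {gc IH Ee} => [|? s] [].
  have stay : tape_act (ohead s) MStay (scanned l (map Some s ++ nseq e None)) =
      scanned l (map Some s ++ nseq e None) by rewrite /scanned Eh.
  have [e' IH'] := IH (d :: l) e'' p ts (o ++ print_bit o').
  exists e'; apply: RunsStep.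
    by rewrite /fview /= map_set_tape /= Eh gc.
  rewrite mact_at stay; apply: RunsStep.
    by rewrite /fview /= map_set_tape /= Eh gc.
  rewrite mact_at /scanned /= Ee; move: IH'.
  rewrite rev_cons cat_rcons -catA.
  suff -> : oapp (rcons (oapp (rcons o) o (omap xpredT o')))
              (oapp (rcons o) o (omap xpredT o')) o' = o ++ print_bit o' by [].
  by case: (o') => [b|] /=; rewrite ?cats0 // -!cats1 -catA.
- move=> c c' o' s' out cf gc _ IH l e p ts o.
  have Eh : head None (map Some [::] ++ nseq e None) = None :> option Sy.
    by case: e.
  have stay : tape_act None MStay (scanned l (map Some [::] ++ nseq e None)) =
      scanned l (map Some [::] ++ nseq e None) by rewrite /scanned Eh.
  have [e' IH'] := IH l e p ts (o ++ print_bit o').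
  exists e'; apply: RunsStep.
    by rewrite /fview /= map_set_tape /= Eh gc.
  rewrite mact_at stay; apply: RunsStep.
    by rewrite /fview /= map_set_tape /= Eh gc.
  rewrite mact_at stay; move: IH'.
  rewrite -catA.
  suff -> : oapp (rcons (oapp (rcons o) o (omap xpredT o')))
              (oapp (rcons o) o (omap xpredT o')) o' = o ++ print_bit o' by [].
  by case: (o') => [b|] /=; rewrite ?cats0 // -!cats1 -catA.
Qed.

Lemma exec_sweep x s s' out cf p ts o :
  sweeps c0 s s' out cf -> holds (tnth ts k) s ->
  exists2 tp, holds tp s' &
    exec x sweep (Memory p ts o) (flag cf) (Memory p (set_tape k tp ts) (o ++ out)).
Proof.
move=> sw [e Etp]; have [e' R] := runs_scan x sw [::] e p ts o.
exists (Tape [::] None (map Some s' ++ nseq e' None)); first by exists e'.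
rewrite -[ts in Memory p ts o](set_tape_id k); apply: RunsStep.
  by rewrite /fview /=.
by rewrite map_set_tape mact_at Etp.
Qed.

End Sweep.

(** * Total-correctness triples over tape contents *)

Section Triples.
Variables (Sy : finType) (K : nat) (x : seq bool).

Record astate := AState {
  apos : nat;
  acontents : seq (seq Sy);
  aout : seq bool }.

Definition rep (m : memory Sy K) (a : astate) : Prop :=
  [/\ mpos m = apos a, mout m = aout a &
      forall k : 'I_K, holds (tnth (mtapes m) k) (nth [::] (acontents a) k)].

Definition triple (F : frag Sy K) (a : astate) (b : bool) (a' : astate) : Prop :=
  forall m, rep m a -> exists2 m', exec x F m b m' & rep m' a'.

Lemma triple_emit o p cs out :
  triple (emit Sy K o) (AState p cs out) true
    (AState p cs (oapp (rcons out) out o)).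
Proof.
move=> [p' ts out'] [/= -> -> hts].
by eexists; first exact: exec_emit.
Qed.

Lemma triple_rewind p cs out : p <= (size x).+1 ->
  triple (rewind Sy K) (AState p cs out) true (AState 1 cs out).
Proof.
move=> lep [p' ts out'] [/= Ep -> hts].
by eexists; first by apply: exec_rewind; rewrite Ep.
Qed.

Lemma triple_seqf F G a b a1 b' a2 :
  triple F a b a1 -> triple G a1 b' a2 -> triple (seqf F G) a b' a2.
Proof.
move=> TF TG m /TF[m1 RF /TG[m2 RG rm2]].
by exists m2 => //; apply: exec_seqf RF RG.
Qed.

Lemma triple_dowhile_last F a a1 :
  triple F a false a1 -> triple (dowhile F) a false a1.
Proof.
by move=> TF m /TF[m1 RF rm1]; exists m1 => //; apply: exec_dowhile_last.
Qed.

Lemma triple_dowhile_again F a a1 b a2 :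
  triple F a true a1 -> triple (dowhile F) a1 b a2 ->
  triple (dowhile F) a b a2.
Proof.
move=> TF TG m /TF[m1 RF /TG[m2 RG rm2]].
by exists m2 => //; apply: exec_dowhile_again RF RG.
Qed.

Lemma triple_casef F p cs out b a :
  p <= (size x).+1 ->
  let o := bit_of_insym (read_input x p) in
  triple (F o) (AState (minn p.+1 (size x).+1) cs out) b a ->
  triple (casef F) (AState p cs out) (isSome o) a.
Proof.
move=> lep o TF [p' ts out'] [/= Ep Eo hts].
have [|m R rm] := TF (Memory (input_move x MRight p') ts out').
  by split; rewrite //= Ep.
rewrite /o -Ep in R *; exists m => //.
exact: (@exec_casef _ _ x F (Memory p' ts out') b m R).
Qed.

Lemma triple_sweep (C : finType) g flag (c0 : C) (k : 'I_K) s s' sout cf p cs out :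
  sweeps g c0 s s' sout cf -> nth [::] cs k = s ->
  triple (sweep g flag c0 k) (AState p cs out) (flag cf)
    (AState p (set_nth [::] cs k s') (out ++ sout)).
Proof.
move=> sw Es [p' ts out'] [/= -> -> hts].
have [|tp htp R] := exec_sweep flag x p (ts := ts) out sw (k := k).
  by rewrite -Es.
eexists; [exact: R|split=> //= i]; rewrite tnth_mktuple nth_set_nth /=.
by case: (i =P k) => [->|/eqP ne]; rewrite ?eqxx //; move: ne; rewrite -val_eqE /= => /negPf->.
Qed.

End Triples.

(** * Binary registers and loop counters *)

Definition binary (n : nat) : seq bool := bits (up_log 2 n.+1) n.

Lemma bitsS w n : bits w.+1 n = odd n :: bits w n./2.
Proof.
rewrite /bits /mkseq /= expn0 divn1 (iotaDl 1 0) -map_comp.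
by congr cons; apply: eq_map => i /=; rewrite add1n expnS divnMA divn2.
Qed.

(** Replaces the length computed by [up_log] with a recursion by halving, the form in which carries
    propagate. *)
Lemma binary_half n : 0 < n -> binary n = odd n :: binary n./2.
Proof.
move=> n_gt0; rewrite /binary -bitsS; congr bits.
have /andP[] := up_log_bounds (isT : 1 < 2) (n_gt0 : 1 < n.+1).
case E: (up_log 2 n.+1) => [|w] /=.
  by have := up_log_gt0 2 n.+1; rewrite E; lia.
move=> lo hi; congr S; case: w => [|w] in E lo hi *.
  have n1 : n = 1 by move: hi; rewrite expn1; lia.
  by rewrite n1.
by symmetry; apply: up_log_eq => //; move: lo hi; rewrite !expnS; lia.
Qed.

Lemma size_binary_leq n h : n < 2 ^ h -> size (binary n) <= h.
Proof. by rewrite size_mkseq => lt_n; apply: up_log_min. Qed.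

Lemma ltn_size_binary n : n < 2 ^ size (binary n).
Proof. by rewrite size_mkseq; apply: up_logP. Qed.

Lemma enc_natE n :
  enc_nat n = flatten [seq [:: true; b] | b <- binary n] ++ [:: false].
Proof. by []. Qed.

Section Registers.
Variable m : nat.
Local Notation Sy := 'I_m.+2.

Definition digit (d : nat) : Sy := inord d.

Lemma bool_digitK (b : bool) : digit b = b :> nat.
Proof. by rewrite inordK //; case: b. Qed.

Definition register (n : nat) : seq Sy :=
  [seq digit (nat_of_bool b) | b <- binary n].

(** A constant [j] is added in one pass, least significant bit first, by starting with [j] itself as
    the carry; halving keeps the carry at most [j], so it fits in a finite state. A blank counts as
    0, and the pass stops on a blank with carry 0, hence produces no leading zeros. *)
Definition add_step j (write print : bool) (c : 'I_j.+1) (o : option Sy) :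
    option ('I_j.+1 * option Sy * option bool) :=
  let tot := oapp (@nat_of_ord _) 0 o + c in
  if (o == None) && (c == 0 :> nat) then None
  else Some (inord tot./2, if write then Some (digit (odd tot)) else o,
             if print then Some (odd tot) else None).

Lemma sweeps_add j write print n (c : 'I_j.+1) :
  sweeps (@add_step j write print) c (register n)
    (register (if write then n + c else n))
    (if print then flatten [seq [:: true; b] | b <- binary (n + c)] else [::])
    ord0.
Proof.
have [h] := ubnP (n + c); elim: h n c => // h IHh n c; rewrite ltnS => le_h.
have [n0|n_gt0] := posnP n.
  subst n; have [c0|c_gt0] := posnP c.
    have -> : c = ord0 by apply: val_inj.
    by rewrite addn0 !if_same; apply: SweepStop.
  have Ec : (inord c./2 : 'I_j.+1) = c./2 :> nat.
    by rewrite inordK //; have := ltn_ord c; lia.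
  have {IHh} := IHh 0 (inord c./2 : 'I_j.+1); rewrite Ec !add0n => IH.
  rewrite /register [binary 0]/=; rewrite [in X in if print then X else _]binary_half //=.
  case: write IH => IH.
    rewrite binary_half //= (_ : (if print then _ else _) =
      print_bit (if print then Some (odd c) else None) ++
      (if print then flatten [seq [:: true; b] | b <- binary c./2] else [::])); last by case: print {IH}.
    apply: (@SweepStep _ _ _ _ [::] (inord c./2)); first by rewrite /add_step /= add0n gtn_eqF.
    by apply: IH; lia.
  rewrite (_ : (if print then _ else _) =
      print_bit (if print then Some (odd c) else None) ++
      (if print then flatten [seq [:: true; b] | b <- binary c./2] else [::])); last by case: print {IH}.
  apply: (@SweepStay _ _ _ _ (inord c./2)); first by rewrite /add_step /= add0n gtn_eqF.
  by apply: IH; lia.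
have tot_gt0 : 0 < n + c by rewrite addn_gt0 n_gt0.
have Ec : (inord (odd n + c)./2 : 'I_j.+1) = (odd n + c)./2 :> nat.
  by rewrite inordK //; have := ltn_ord c; lia.
(* The rest of the pass is again an addition, of the halved register and the new carry, with a
   smaller sum. *)
have Eh : (n + c)./2 = n./2 + (odd n + c)./2 by lia.
have Eo : odd (n + c) = odd (odd n + c) by rewrite !oddD oddb.
have {IHh} := IHh n./2 (inord (odd n + c)./2 : 'I_j.+1); rewrite Ec => IH.
rewrite {1}/register (binary_half n_gt0) map_cons.
rewrite (_ : (if print then _ else _) =
    print_bit (if print then Some (odd (odd n + c)) else None) ++
    (if print then flatten [seq [:: true; b] | b <- binary (n + c)./2] else [::])); last first.
  by case: print {IH}; rewrite // (binary_half tot_gt0) Eo.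
rewrite (_ : register (if write then _ else _) =
    digit (if write then odd (odd n + c) else odd n) ::
    register (if write then (n + c)./2 else n./2)); last first.
  by case: write {IH}; rewrite /register ?(binary_half tot_gt0) ?(binary_half n_gt0) ?Eo.
apply: SweepStep; last by rewrite /= Eh; apply: IH; lia.
by rewrite /add_step /= bool_digitK; case: write {IH}.
Qed.

Fixpoint digits b l v : seq Sy :=
  if l is l'.+1 then digit (v %% b) :: digits b l' (v %/ b) else [::].

Lemma digits0 b l : digits b l 0 = nseq l (digit 0).
Proof. by elim: l => //= l IHl; rewrite mod0n div0n IHl. Qed.

Definition incr_step b (c : bool) (o : option Sy) :
    option (bool * option Sy * option bool) :=
  if o is Some d then Some (b <= d + c, Some (digit ((d + c) %% b)), None)
  else None.

Lemma sweeps_incr b : 1 < b <= m.+2 -> forall l v (c : bool), v < b ^ l ->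
  sweeps (incr_step b) c (digits b l v) (digits b l (v + c)) [::]
    (b ^ l <= v + c).
Proof.
case/andP=> b_gt1 le_b; elim=> [|l IHl] v c lt_v.
  have -> : v = 0 by move: lt_v; rewrite expn0; lia.
  by rewrite expn0 add0n lt0b; apply: SweepStop.
have b_gt0 : 0 < b by apply: ltnW.
have lt_mod : v %% b < b by rewrite ltn_mod.
have Ed : digit (v %% b) = v %% b :> nat by rewrite inordK //; apply: leq_trans le_b.
have Ediv : (v + c) %/ b = v %/ b + (b <= v %% b + c).
  rewrite {1}(divn_eq v b) -addnA divnMDl //; congr addn.
  case: leqP => [le_bc|]; last exact: divn_small.
  have -> : v %% b + c = b by case: c le_bc; lia.
  by rewrite divnn b_gt0.
rewrite /= -[[::]]/(print_bit None ++ [::]).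
apply: (@SweepStep _ _ _ _ _ (b <= v %% b + c)).
  by rewrite /= Ed modnDml.
rewrite /= Ediv.
(* The counter overflows on [l.+1] digits exactly when its quotient by [b], with the carry,
   overflows on [l]. *)
rewrite (_ : b ^ l.+1 <= v + c = (b ^ l <= v %/ b + (b <= v %% b + c))).
  by apply: IHl; rewrite ltn_divLR // -expnSr.
by rewrite -Ediv leq_divRL // expnSr.
Qed.

Definition reset_step (c : unit) (o : option Sy) :
    option (unit * option Sy * option bool) :=
  if o is Some _ then Some (tt, Some (digit 0), None) else None.

Lemma sweeps_reset s :
  sweeps reset_step tt s (nseq (size s) (digit 0)) [::] tt.
Proof.
elim: s => [|d s IHs] /=; first exact: SweepStop.
by rewrite -[[::]]/(print_bit None ++ [::]); apply: (@SweepStep _ _ _ _ _ tt).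
Qed.

(** The exit of the increment is the negated overflow: starting from zeros, [F] runs [b ^ l] times
    and the counter is back to zeros, ready for another loop, possibly in another base. *)
Definition loop b (F : frag Sy 3) : frag Sy 3 :=
  dowhile (seqf F (sweep (incr_step b) negb true ord0)).

Lemma triple_loop x b l F p (cs : nat -> seq (seq Sy)) (out : nat -> seq bool) :
  1 < b <= m.+2 ->
  (forall i s, i < b ^ l ->
    triple x F (AState p (s :: cs i) (out i)) true
               (AState p (s :: cs i.+1) (out i.+1))) ->
  triple x (loop b F) (AState p (nseq l (digit 0) :: cs 0) (out 0)) false
    (AState p (nseq l (digit 0) :: cs (b ^ l)) (out (b ^ l))).
Proof.
move=> b_ok TF; rewrite -(digits0 b).
have b_gt0 : 0 < b by case/andP: b_ok; lia.
have bl_gt0 : 0 < b ^ l by rewrite expn_gt0 b_gt0.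
have incr v : v < b ^ l ->
    triple x (sweep (incr_step b) negb true (ord0 : 'I_3))
    (AState p (digits b l v :: cs v.+1) (out v.+1)) (v.+1 < b ^ l)
    (AState p (digits b l v.+1 :: cs v.+1) (out v.+1)).
  move=> lt_v; rewrite ltnNge.
  have := sweeps_incr b_ok true lt_v; rewrite addn1 => sw.
  have := @triple_sweep _ 3 x _ _ negb true ord0 _ _ _ _ p
    (digits b l v :: cs v.+1) (out v.+1) sw erefl.
  by rewrite /= cats0.
have wrap : digits b l (b ^ l) = digits b l 0.
  by elim: (l) => //= l' IHl; rewrite mod0n div0n expnS modnMr mulKn ?IHl.
(* Induction on the number [d] of iterations left after the current one. *)
suff all_v d v : d + v.+1 = b ^ l ->
    triple x (loop b F) (AState p (digits b l v :: cs v) (out v)) false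
      (AState p (digits b l (b ^ l) :: cs (b ^ l)) (out (b ^ l))).
  by rewrite -{2}wrap; apply: (all_v (b ^ l).-1); rewrite addn1 prednK.
elim: d v => [|d IHd] v Ev.
  apply: triple_dowhile_last; apply: triple_seqf (TF _ _ _) _; first by lia.
  by have := incr v; rewrite -Ev add0n ltnn; apply.
apply: triple_dowhile_again (IHd v.+1 _); last by lia.
apply: triple_seqf (TF _ _ _) _; first by lia.
by have := incr v; rewrite (_ : v.+1 < b ^ l); [apply; lia|lia].
Qed.

End Registers.

(** * Straight-line programs *)

(* A symbolic reference is an offset from one of two gate numbers kept in
   registers: [true] selects the pointer, [false] the current position. *)
Definition sref : Type := bool * nat.

Inductive sgate :=
| SInput of nat
| SConst of bool
| SNot of sref
| SAnd of sref & sref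
| SOr of sref & sref.

Definition rval (cu pt : nat) (r : sref) : nat := (if r.1 then pt else cu) + r.2.

Definition inst (cu pt : nat) (g : sgate) : gate :=
  match g with
  | SInput i => Input i
  | SConst b => Const b
  | SNot r => Not (rval cu pt r)
  | SAnd r r' => And (rval cu pt r) (rval cu pt r')
  | SOr r r' => Or (rval cu pt r) (rval cu pt r')
  end.

(** The closing [false] of [enc_seq] is left out, so that concatenation is preserved and gates can
    be printed piecewise. *)
Definition enc_gates (gs : seq gate) : seq bool :=
  flatten [seq true :: enc_gate g | g <- gs].

Lemma enc_gates_cat gs gs' : enc_gates (gs ++ gs') = enc_gates gs ++ enc_gates gs'.
Proof. by rewrite /enc_gates map_cat flatten_cat. Qed.

Section Printing.
Variable m : nat.
Local Notation Sy := 'I_m.+2.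
Local Notation frag3 := (frag Sy 3).

Definition registers (p : nat) (s : seq Sy) (cu pt : nat) (out : seq bool) :=
  AState p [:: s; register m cu; register m pt] out.

Definition reg_tape (r : bool) : 'I_3 :=
  if r then Ordinal (isT : 2 < 3) else Ordinal (isT : 1 < 3).

Definition puts (s : seq bool) : frag3 :=
  foldr (fun b => seqf (emit Sy 3 (Some b))) (emit Sy 3 None) s.

Definition add_reg (r : bool) (j : nat) : frag3 :=
  sweep (@add_step m j true false) xpredT ord_max (reg_tape r).

Definition print_ref (r : sref) : frag3 :=
  seqf (sweep (@add_step m r.2 false true) xpredT ord_max (reg_tape r.1))
       (emit Sy 3 (Some false)).

Definition print_gate (g : sgate) : frag3 :=
  match g with
  | SInput i => puts (enc_gate (Input i))
  | SConst b => puts (enc_gate (Const b))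
  | SNot r => seqf (puts [:: false; true]) (print_ref r)
  | SAnd r r' =>
      seqf (puts [:: true; false]) (seqf (print_ref r) (print_ref r'))
  | SOr r r' =>
      seqf (puts [:: true; true]) (seqf (print_ref r) (print_ref r'))
  end.

Definition print_all (T : Type) (print : T -> frag3) (s : seq T) : frag3 :=
  foldr (fun a => seqf (seqf (emit Sy 3 (Some true)) (print a)))
    (emit Sy 3 None) s.

Variable x : seq bool.
Local Notation triple := (triple x).

Lemma triple_puts w p s cu pt out :
  triple (puts w) (registers p s cu pt out) true
    (registers p s cu pt (out ++ w)).
Proof.
elim: w out => [|b w IHw] out /=; first by rewrite cats0; exact: triple_emit.
apply: (@triple_seqf _ _ _ _ _ _ true); first exact: triple_emit.
by have := IHw (rcons out b); rewrite cat_rcons.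
Qed.

Lemma triple_add_reg (r : bool) j p s cu pt out :
  triple (add_reg r j) (registers p s cu pt out) true
    (registers p s (if r then cu else cu + j) (if r then pt + j else pt) out).
Proof.
have := @triple_sweep _ 3 x _ _ xpredT ord_max (reg_tape r) _ _ _ _ p
  [:: s; register m cu; register m pt] out
  (@sweeps_add m j true false (if r then pt else cu) ord_max).
by rewrite cats0; case: r => /= /(_ erefl).
Qed.

Lemma triple_print_ref r p s cu pt out :
  triple (print_ref r) (registers p s cu pt out) true
    (registers p s cu pt (out ++ enc_nat (rval cu pt r))).
Proof.
rewrite enc_natE catA cats1; apply: (@triple_seqf _ _ _ _ _ _ true); last exact: triple_emit.
have := @triple_sweep _ 3 x _ _ xpredT ord_max (reg_tape r.1) _ _ _ _ p
  [:: s; register m cu; register m pt] out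
  (@sweeps_add m r.2 false true (if r.1 then pt else cu) ord_max).
by rewrite /rval; case: r.1 => /= /(_ erefl).
Qed.

Lemma triple_print_gate g p s cu pt out :
  triple (print_gate g) (registers p s cu pt out) true
    (registers p s cu pt (out ++ enc_gate (inst cu pt g))).
Proof.
case: g => [i|b|r|r r'|r r'].
- exact: triple_puts.
- exact: triple_puts.
- rewrite -[enc_gate _]/([:: false; true] ++ enc_nat (rval cu pt r)) catA.
  apply: (@triple_seqf _ _ _ _ _ _ true); first exact: triple_puts.
  exact: triple_print_ref.
- rewrite -[enc_gate _]/([:: true; false] ++ enc_nat (rval cu pt r) ++
                        enc_nat (rval cu pt r')) (catA out) (catA (_ ++ _)).
  apply: (@triple_seqf _ _ _ _ _ _ true); first exact: triple_puts.
  by apply: (@triple_seqf _ _ _ _ _ _ true); exact: triple_print_ref.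
- rewrite -[enc_gate _]/([:: true; true] ++ enc_nat (rval cu pt r) ++
                        enc_nat (rval cu pt r')) (catA out) (catA (_ ++ _)).
  apply: (@triple_seqf _ _ _ _ _ _ true); first exact: triple_puts.
  by apply: (@triple_seqf _ _ _ _ _ _ true); exact: triple_print_ref.
Qed.

Lemma triple_print_all (T : Type) (print : T -> frag3) (enc : T -> seq bool)
    p s cu pt (l : seq T) :
  (forall a out, triple (print a) (registers p s cu pt out) true
     (registers p s cu pt (out ++ enc a))) ->
  forall out, triple (print_all print l) (registers p s cu pt out) true
    (registers p s cu pt (out ++ flatten [seq true :: enc a | a <- l])).
Proof.
move=> Tprint; elim: l => [|a l IHl] out /=.
  by rewrite cats0; exact: triple_emit.
rewrite -cat_rcons catA; apply: (@triple_seqf _ _ _ _ _ _ true) (IHl _).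
by apply: (@triple_seqf _ _ _ _ _ _ true); [exact: triple_emit|exact: Tprint].
Qed.

Definition print_prog := print_all print_gate.

Lemma triple_print_prog sp p s cu pt out :
  triple (print_prog sp) (registers p s cu pt out) true
    (registers p s cu pt
       (out ++ enc_gates (map (inst cu pt) sp))).
Proof.
rewrite /enc_gates -map_comp.
by apply: (triple_print_all (enc := fun g => enc_gate (inst cu pt g)));
  move=> *; exact: triple_print_gate.
Qed.

End Printing.

(** * Values computed by straight-line programs *)

Section Circuits.
Variables (nin : nat) (inp : seq bool).

Definition run : seq bool -> seq gate -> seq bool :=
  foldl (fun vals g => rcons vals (gate_val inp vals g)).

Fixpoint gates_wf (k : nat) (gs : seq gate) : bool :=
  if gs is g :: gs' then gate_wf nin k g && gates_wf k.+1 gs' else true.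

(** Stated relative to the values of the gates already laid, so that correct blocks compose by
    [computes_cat]. *)
Definition computes (vals : seq bool) (gs : seq gate) (u : seq bool) : Prop :=
  gates_wf (size vals) gs /\ run vals gs = vals ++ u.

Lemma size_run vals gs : size (run vals gs) = size vals + size gs.
Proof.
by elim: gs vals => [|g gs IH] vals /=; rewrite ?addn0 // IH size_rcons addnS.
Qed.

Lemma gates_wf_cat k gs gs' :
  gates_wf k (gs ++ gs') = gates_wf k gs && gates_wf (k + size gs) gs'.
Proof.
by elim: gs k => [|g gs IH] k /=; rewrite ?addn0 // IH addSnnS andbA.
Qed.

Lemma gates_wf_nth k gs i : gates_wf k gs -> i < size gs ->
  gate_wf nin (k + i) (nth (Const false) gs i).
Proof.
elim: gs k i => // g gs IH k [|i] /= /andP[wf_g wf_gs]; first by rewrite addn0.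
by rewrite ltnS addnS -addSn; exact: IH.
Qed.

Lemma computes_size vals gs u : computes vals gs u -> size u = size gs.
Proof.
by case=> _ /(congr1 size); rewrite size_run size_cat => /addnI.
Qed.

Lemma computes_cat vals gs u gs' u' :
  computes vals gs u -> computes (vals ++ u) gs' u' ->
  computes vals (gs ++ gs') (u ++ u').
Proof.
move=> C1 [wf2 run2]; have Eu := computes_size C1; case: C1 => wf1 run1.
split; first by rewrite gates_wf_cat wf1 -Eu -size_cat.
by rewrite /run foldl_cat -/(run vals gs) run1 -/(run _ _) run2 catA.
Qed.

Lemma computes_nil vals : computes vals [::] [::].
Proof. by split; rewrite ?cats0. Qed.

Lemma computes_cons vals g gs u :
  gate_wf nin (size vals) g -> computes (rcons vals (gate_val inp vals g)) gs u ->
  computes vals (g :: gs) (gate_val inp vals g :: u).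
Proof.
by move=> wf_g [wf_gs Eu]; split; rewrite /= ?wf_g -?cat_rcons // -(size_rcons _ (gate_val inp vals g)).
Qed.

Lemma computes_mux vals r i1 i2 c b1 b2 :
  r < size vals -> i1 < size vals -> i2 < size vals ->
  nth false vals r = c -> nth false vals i1 = b1 -> nth false vals i2 = b2 ->
  computes vals
    [:: Not r; And r i1; And (size vals) i2; Or (size vals).+1 (size vals).+2]
    [:: ~~ c; c && b1; ~~ c && b2; (c && b1) || (~~ c && b2)].
Proof.
move=> lt_r lt1 lt2 Er E1 E2; split.
  by rewrite /=; lia.
rewrite /run /= -!cats1 -!catA /= !nth_cat lt_r lt1 lt2 Er E1 E2.
have -> : (size vals).+1 < size vals = false by lia.
have -> : (size vals).+2 < size vals = false by lia.
have -> : (size vals).+1 - size vals = 1 by lia.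
have -> : (size vals).+2 - size vals = 2 by lia.
by rewrite ltnn subnn.
Qed.

Lemma nth_cat_prefix (vals u : seq bool) i :
  i < size vals -> nth false (vals ++ u) i = nth false vals i.
Proof. by rewrite nth_cat => ->. Qed.

(* One less than the size of a program for [m] variables. *)
Fixpoint shannon_size (m : nat) : nat :=
  if m is m'.+1 then (shannon_size m').*2 + 5 else 0.

(* [o] is the number of the first gate, relative to the current position. *)
Fixpoint shannon (f : seq bool -> bool) (rs : seq sref) (o : nat) : seq sgate :=
  if rs is r :: rs' then
    let z := shannon_size (size rs') in
    let e := o + z.+1.*2 in
    shannon (fun v => f (true :: v)) rs' o ++
    shannon (fun v => f (false :: v)) rs' (o + z.+1) ++
    [:: SNot r; SAnd r (false, o + z); SAnd (false, e) (false, o + z.+1 + z);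
        SOr (false, e.+1) (false, e.+2)]
  else [:: SConst (f [::])].

Definition refs_values cu pt (vals : seq bool) (rs : seq sref) : seq bool :=
  [seq nth false vals (rval cu pt r) | r <- rs].

Lemma refs_values_cat cu pt vals u rs :
  all (fun r => rval cu pt r < size vals) rs ->
  refs_values cu pt (vals ++ u) rs = refs_values cu pt vals rs.
Proof. by move/allP=> lt_rs; apply/eq_in_map => r /lt_rs; exact: nth_cat_prefix. Qed.

Lemma refs_in_cat cu pt (vals u : seq bool) rs :
  all (fun r => rval cu pt r < size vals) rs ->
  all (fun r => rval cu pt r < size (vals ++ u)) rs.
Proof. by apply: sub_all => r; rewrite size_cat => lt_r; apply: ltn_addr. Qed.

(** The two cofactors on the first reference are laid one after the other, each with its value in
    its last gate, and a multiplexer of four gates selects one. The length does not depend on [f],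
    which is what makes all cells equally long. *)
Lemma computes_shannon cu pt f rs o vals :
  size vals = cu + o -> all (fun r => rval cu pt r < size vals) rs ->
  exists2 w, size w = shannon_size (size rs) &
    computes vals [seq inst cu pt g | g <- shannon f rs o]
      (rcons w (f (refs_values cu pt vals rs))).
Proof.
elim: rs f o vals => [|r rs IH] f o vals Ev.
  by exists [::] => //; apply: computes_cons => //; exact: computes_nil.
move=> /= /andP[lt_r lt_rs]; set z := shannon_size (size rs).
have [w1 Ew1 C1] := IH (fun v => f (true :: v)) o vals Ev lt_rs.
set b1 := f _ in C1; set vals1 := vals ++ rcons w1 b1.
have Ev1 : size vals1 = cu + (o + z.+1).
  by rewrite size_cat size_rcons Ew1 Ev addnA.
have [w2 Ew2] := IH (fun v => f (false :: v)) _ vals1 Ev1 (refs_in_cat _ lt_rs).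
rewrite refs_values_cat //; set b2 := f _ => C2.
set vals2 := vals1 ++ rcons w2 b2.
have Ev2 : size vals2 = cu + (o + z.+1.*2).
  by rewrite size_cat size_rcons Ew2 Ev1 -/z; lia.
set c := nth false vals (rval cu pt r).
have Er : nth false vals2 (rval cu pt r) = c.
  by rewrite /vals2 -catA nth_cat_prefix.
have E1 : nth false vals2 (cu + (o + z)) = b1.
  rewrite /vals2 nth_cat_prefix ?Ev1; last by lia.
  have -> : cu + (o + z) = size (vals ++ w1).
    by rewrite size_cat Ew1 Ev -/z; lia.
  by rewrite /vals1 -cats1 catA nth_cat ltnn subnn.
have E2 : nth false vals2 (cu + (o + z.+1 + z)) = b2.
  have -> : cu + (o + z.+1 + z) = size (vals1 ++ w2).
    by rewrite size_cat Ew2 Ev1 -/z; lia.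
  by rewrite /vals2 -cats1 catA nth_cat ltnn subnn.
have lt_r2 : rval cu pt r < size vals2.
  by rewrite /vals2 -catA size_cat ltn_addr.
exists (rcons w1 b1 ++ rcons w2 b2 ++ [:: ~~ c; c && b1; ~~ c && b2]).
  by rewrite !size_cat !size_rcons Ew1 Ew2 /= -/z; lia.
rewrite !rcons_cat !map_cat; apply: computes_cat C1 (computes_cat C2 _).
rewrite -/vals1 -/vals2 /=.
have -> : rval cu pt (false, o + z.+1.*2) = size vals2 by [].
have -> : rval cu pt (false, (o + z.+1.*2).+1) = (size vals2).+1.
  by rewrite Ev2 -!addnS.
have -> : rval cu pt (false, (o + z.+1.*2).+2) = (size vals2).+2.
  by rewrite Ev2 -!addnS.
have -> : f (c :: refs_values cu pt vals rs) = (c && b1) || (~~ c && b2).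
  by rewrite /b1 /b2; case: (c); rewrite ?orbF.
by apply: computes_mux; rewrite // Ev2 /rval /=; lia.
Qed.

(** Each bit owns a block of [z.+1] gates; the last one carries it, the others being intermediate
    results. *)
Definition carries (z : nat) (u bs : seq bool) : Prop :=
  size u = size bs * z.+1 /\
  forall s, s < size bs -> nth false u (s * z.+1 + z) = nth false bs s.

Lemma carries_nil z : carries z [::] [::].
Proof. by []. Qed.

Lemma carries_cons z w b u bs :
  size w = z -> carries z u bs -> carries z (rcons w b ++ u) (b :: bs).
Proof.
move=> Ew [Eu nth_u]; split=> [|[|s]] /=.
- by rewrite size_cat size_rcons Ew Eu mulSn.
- by move=> _; rewrite nth_cat size_rcons Ew leqnn nth_rcons Ew ltnn eqxx.
- rewrite ltnS => /nth_u <-; rewrite nth_cat size_rcons Ew mulSn -addnA.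
  by rewrite ltnNge leq_addr /= addKn.
Qed.

Fixpoint shannons (fs : seq (seq bool -> bool)) (rs : seq sref) (o : nat) :
    seq sgate :=
  if fs is f :: fs' then
    shannon f rs o ++ shannons fs' rs (o + (shannon_size (size rs)).+1)
  else [::].

Lemma computes_shannons cu pt fs rs o vals :
  size vals = cu + o -> all (fun r => rval cu pt r < size vals) rs ->
  exists2 u, computes vals [seq inst cu pt g | g <- shannons fs rs o] u &
    carries (shannon_size (size rs)) u
      [seq f (refs_values cu pt vals rs) | f : seq bool -> bool <- fs].
Proof.
elim: fs o vals => [|f fs IH] o vals Ev lt_rs /=.
  by exists [::]; [exact: computes_nil|exact: carries_nil].
have [w Ew C1] := computes_shannon f Ev lt_rs.
have Ev1 : size (vals ++ rcons w (f (refs_values cu pt vals rs))) =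
    cu + (o + (shannon_size (size rs)).+1).
  by rewrite size_cat size_rcons Ew Ev addnA.
have [u C2] := IH _ _ Ev1 (refs_in_cat _ lt_rs).
rewrite refs_values_cat // => Cu; rewrite map_cat.
by eexists; [exact: computes_cat C1 C2|exact: carries_cons].
Qed.

(** The [z] dummy gates give a constant bit the same layout as a computed one, so that the first row
    is addressed like the others. *)
Definition constants (z : nat) (bs : seq bool) : seq sgate :=
  flatten [seq rcons (nseq z (SConst false)) (SConst b) | b <- bs].

Lemma computes_constants cu pt z bs vals :
  exists2 u, computes vals [seq inst cu pt g | g <- constants z bs] u &
    carries z u bs.
Proof.
elim: bs vals => [|b bs IH] vals /=.
  by exists [::]; [exact: computes_nil|exact: carries_nil].
have C1 : computes vals [seq inst cu pt g | g <- rcons (nseq z (SConst false)) (SConst b)]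
    (rcons (nseq z false) b).
  elim: (z) vals => [|z' IHz] vals' /=.
    by apply: computes_cons => //; exact: computes_nil.
  by apply: computes_cons => //; exact: IHz.
have [u C2 Cu] := IH (vals ++ rcons (nseq z false) b).
rewrite /constants /= map_cat.
by eexists; [exact: computes_cat C1 C2|apply: carries_cons; rewrite ?size_nseq].
Qed.

Lemma computes_inputs cu pt i k vals : i + k <= nin ->
  computes vals [seq inst cu pt g | g <- [seq SInput j | j <- iota i k]]
    [seq nth false inp j | j <- iota i k].
Proof.
elim: k i vals => [|k IHk] i vals le_i /=; first exact: computes_nil.
by apply: computes_cons => /=; [lia|apply: IHk; lia].
Qed.

End Circuits.

(** * Tableaux *)

Section Helix.
Variables (A : Type) (a0 : A) (F : A -> A -> A -> A -> A) (P : nat) (row : seq A).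
Hypotheses (P_gt1 : 1 < P) (size_row : size row = P.+1).

Definition helix_step (s : seq A) : seq A :=
  let n := size s in
  rcons s (F (nth a0 s n.-1) (nth a0 s (n - P.+1)) (nth a0 s (n - P))
             (nth a0 s (n - P).+1)).

(* Rows of length [P] written one after the other: each cell depends on its
   predecessor and on the three cells above it, the rows being glued together
   so that no border case arises. *)
Definition helix (k : nat) : seq A := iter k helix_step row.

Lemma size_helix k : size (helix k) = P.+1 + k.
Proof. by elim: k => [|k IHk] /=; rewrite ?addn0 // size_rcons IHk addnS. Qed.

Lemma nth_helixS k i : i < P.+1 + k -> nth a0 (helix k.+1) i = nth a0 (helix k) i.
Proof. by move=> lt_i; rewrite /= nth_rcons size_helix lt_i. Qed.

Lemma nth_helix_row k i : i < P.+1 -> nth a0 (helix k) i = nth a0 row i.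
Proof. by move=> lt_i; elim: k => // k IHk; rewrite nth_helixS // ltn_addr. Qed.

(** Cells are only appended, so the equation true when cell [i] is created persists in all longer
    helices. *)
Lemma nth_helix_rec k i : P < i < P.+1 + k ->
  nth a0 (helix k) i =
  F (nth a0 (helix k) i.-1) (nth a0 (helix k) (i - P.+1))
    (nth a0 (helix k) (i - P)) (nth a0 (helix k) (i - P).+1).
Proof.
case/andP=> lt_Pi; elim: k => [|k IHk]; first by lia.
rewrite addnS ltnS leq_eqVlt => /orP[/eqP-> | lt_i]; last first.
  by rewrite !nth_helixS ?IHk //; lia.
rewrite [in RHS]nth_helixS; last by lia.
rewrite [nth a0 _ (_ - P.+1)]nth_helixS; last by lia.
rewrite [nth a0 _ (P.+1 + k - P)]nth_helixS; last by lia.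
rewrite [nth a0 _ (_ - P).+1]nth_helixS; last by lia.
by rewrite /= /helix_step nth_rcons size_helix ltnn eqxx.
Qed.

End Helix.

(** * The local rule of a Turing machine *)

Section Cells.
Variable M : decider.

Definition cell : Type := option (dstate M) * option (bool + dsym M).

(** A head that halts is sent to its own cell, which makes halted configurations fixed points of the
    local rule. *)
Definition sent (m : move) (c : cell) : option (dstate M) :=
  if c.1 is Some q then
    match ddelta q c.2, m with
    | Some (q', _, MLeft), MLeft | Some (q', _, MStay), MStay
    | Some (q', _, MRight), MRight => Some q'
    | None, MStay => Some q
    | _, _ => None
    end
  else None.

Definition written (c : cell) : option (bool + dsym M) :=
  if c.1 is Some q then
    if ddelta q c.2 is Some (_, a, _) then a else c.2
  else c.2.

Definition next_cell (l c r : cell) : cell :=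
  (if sent MRight l is Some q then Some q
   else if sent MStay c is Some q then Some q else sent MLeft r,
   written c).

Definition accepting (c : cell) : bool :=
  if c.1 is Some q then ~~ isSome (ddelta q c.2) && daccept q else false.

(** Tapes are relative to the head; this is the symbol in absolute column [j] when the head is in
    column [p]. Unvisited cells get the default [None], the blank. *)
Definition content (tp : tape (bool + dsym M)) (p j : nat) :=
  if j < p then nth None (tleft tp) (p - j.+1)
  else nth None (tcur tp :: tright tp) (j - p).

Definition cell_at (c : dconf M) (p j : nat) : cell :=
  (if j == p then Some c.1 else None, content c.2 p j).

Definition head_move (c : dconf M) (p : nat) : nat :=
  match ddelta c.1 (tcur c.2) with
  | Some (_, _, MLeft) => p.-1
  | Some (_, _, MRight) => p.+1
  | _ => p
  end.

Lemma nth_behead (T : Type) (a : T) s i : nth a (behead s) i = nth a s i.+1.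
Proof. by case: s => //=; rewrite nth_nil. Qed.

Lemma sent_none m (c : cell) : c.1 = None -> sent m c = None.
Proof. by rewrite /sent => ->. Qed.

(** A neighbour without head sends nothing, so its symbol is left unspecified: [l] and [r] may come
    from another row, as happens at the borders. The hypothesis [0 < p] keeps [p.-1] a genuine left
    move. *)
Lemma next_cell_at (c : dconf M) p j (l r : cell) : 0 < p ->
  (if j == p.+1 then l = cell_at c p p else l.1 = None) ->
  (if j.+1 == p then r = cell_at c p p else r.1 = None) ->
  next_cell l (cell_at c p j) r =
  cell_at (odflt c (dstep c)) (head_move c p) j.
Proof.
case: c => q [L a R]; rewrite /head_move /dstep /= => p_gt0 Hl Hr.
have Epp : cell_at (q, Tape L a R) p p = (Some q, a).
  by rewrite /cell_at /content eqxx ltnn subnn.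
rewrite Epp in Hl Hr.
(* Off the head column, a head can only arrive from the neighbour on the side of the head, and only
   if that neighbour is adjacent to it; on the head column neither neighbour holds a head. *)
have [lt_jp|lt_pj|E] := ltngtP j p.
- have Hl' : l.1 = None by case: eqP Hl => //; lia.
  have Ec : cell_at (q, Tape L a R) p j = (None, nth None L (p - j.+1)).
    by rewrite /cell_at /content lt_jp ltn_eqF.
  rewrite Ec /next_cell (sent_none _ Hl') /= /written /=.
  case: eqP Hr => [Ej -> |ne_j Hr].
    rewrite /sent /=; case Ed: (ddelta q a) => [[[q' a'] []]|] /=;
      rewrite /cell_at /content /= -?Ej ?eqxx ?ltnn ?subnn ?leqnn //=.
    + by rewrite ltn_eqF // subnn.
    + by rewrite ltn_eqF ?ltnS ?leqnSn // subSnn.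
    + by rewrite ltn_eqF // subnn.
  rewrite (sent_none _ Hr); case Ed: (ddelta q a) => [[[q' a'] []]|] /=;
    rewrite /cell_at /content /=.
  + rewrite ltn_eqF; last by lia.
    by rewrite (_ : j < p.-1) ?nth_behead; [congr (_, nth _ _ _); lia|lia].
  + by rewrite ltn_eqF // lt_jp.
  + rewrite (_ : j < p.+1) ?ltn_eqF; [|by lia|by lia].
    by rewrite (_ : p.+1 - j.+1 = (p - j.+1).+1) //; lia.
  + by rewrite ltn_eqF // lt_jp.
- have Hr' : r.1 = None by case: eqP Hr => //; lia.
  have Ec : cell_at (q, Tape L a R) p j = (None, nth None R (j - p.+1)).
    rewrite /cell_at /content gtn_eqF // ltnNge (ltnW lt_pj) /=.
    by rewrite (_ : j - p = (j - p.+1).+1) //; lia.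
  rewrite Ec /next_cell (sent_none _ Hr') /= /written /=.
  case: eqP Hl => [Ej -> |ne_j Hl].
    rewrite /sent /=; case Ed: (ddelta q a) => [[[q' a'] []]|] /=;
      rewrite /cell_at /content /= Ej.
    + rewrite gtn_eqF ?subnn; last by lia.
      rewrite ltnNge (leq_trans (leq_pred p)) //=.
      by rewrite (_ : p.+1 - p.-1 = 2) //; lia.
    + by rewrite gtn_eqF // ltnNge leqnSn /= subSnn subnn.
    + by rewrite eqxx ltnn subnn nth0.
    + by rewrite gtn_eqF // ltnNge leqnSn /= subSnn subnn.
  rewrite (sent_none _ Hl); case Ed: (ddelta q a) => [[[q' a'] []]|] /=;
    rewrite /cell_at /content /=.
  + rewrite gtn_eqF; last by lia.
    rewrite ltnNge (_ : p.-1 <= j) /=; last by lia.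
    by rewrite (_ : j - p.-1 = (j - p.+1).+2) //; lia.
  + rewrite gtn_eqF // ltnNge (ltnW lt_pj) /=.
    by rewrite (_ : j - p = (j - p.+1).+1) //; lia.
  + rewrite gtn_eqF; last by lia.
    rewrite ltnNge lt_pj /=.
    rewrite (_ : j - p.+1 = (j - p.+2).+1) /= ?nth_behead //; lia.
  + rewrite gtn_eqF // ltnNge (ltnW lt_pj) /=.
    by rewrite (_ : j - p = (j - p.+1).+1) //; lia.
- subst j; rewrite Epp /next_cell.
  have Hl' : l.1 = None by case: eqP Hl => //; lia.
  have Hr' : r.1 = None by case: eqP Hr => //; lia.
  rewrite (sent_none _ Hl') (sent_none _ Hr') /sent /written /=.
  case Ed: (ddelta q a) => [[[q' a'] []]|] /=; rewrite /cell_at /content /=.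
  + rewrite gtn_eqF ?prednK // ltnNge leq_pred /=.
    by rewrite (_ : p - p.-1 = 1) //; lia.
  + by rewrite eqxx ltnn subnn.
  + by rewrite ltn_eqF // ltnSn subnn.
  + by rewrite eqxx ltnn subnn.
Qed.

End Cells.

(** * The tableau of a halting run *)

Section Tableau.
Variables (M : decider) (x : seq bool) (W : nat).

Let conf t : dconf M := drun t (dinit M x).
Let P := W + W.+1 + (size x).-1.

Definition blank : cell M := (None, None).

(** One cell longer than a row: cell [P] has no cell [i - P - 1] and must be given, though it
    already belongs to the next configuration. *)
Definition first_row : seq (cell M) :=
  nseq W.+1 blank ++
  (Some (dstart M), omap inl (ohead x)) ::
  [seq (None, Some (inl b)) | b <- behead x] ++ nseq W blank.

Lemma size_first_row : size first_row = P.+1.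
Proof.
by rewrite size_cat /= size_cat !size_nseq size_map size_behead /P; lia.
Qed.

Lemma nth_first_row j :
  nth blank first_row j = cell_at (conf 0) W.+1 j.
Proof.
rewrite /first_row nth_cat size_nseq /cell_at /content.
have [lt_j|lt_j|->] := ltngtP j W.+1.
- by rewrite nth_nseq lt_j nth_nil.
- case E: (j - W.+1) => [|i]; first by lia.
  rewrite /= nth_cat size_map size_behead nth_behead.
  have [lt_i|le_i] := ltnP i (size x).-1.
    rewrite (nth_map false); last by lia.
    by rewrite [LHS](nth_map false) ?size_behead // nth_behead.
  rewrite nth_nseq if_same nth_default // size_map; lia.
- by rewrite subnn /=; case: x.
Qed.

Definition marked_cell : Type := cell M * bool.

(** The mark is a running disjunction along the helix, so the last cell alone tells whether some
    computed cell was accepting. *)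
Definition marked_step (prev l c r : marked_cell) : marked_cell :=
  let d := next_cell l.1 c.1 r.1 in (d, prev.2 || accepting d).

Lemma size_marked_row : size [seq (c, false) | c <- first_row] = P.+1.
Proof. by rewrite size_map size_first_row. Qed.

Variable T : nat.
Hypotheses (halted : dstep (drun T (dinit M x)) = None) (lt_TW : T.+1 < W).

Fixpoint head_pos (t : nat) : nat :=
  if t is t'.+1 then head_move (conf t') (head_pos t') else W.+1.

Lemma conf_halted t u : dstep (conf t) = None -> t <= u ->
  conf u = conf t /\ head_pos u = head_pos t.
Proof.
move=> ht /subnK <-; elim: (u - t) => //= v [Ec Ep].
rewrite Ec ht Ep /head_move.
by move: ht; rewrite /dstep; case: ddelta => // -[[]].
Qed.

(** The head moves by at most one column per step and stays put after time [T], so the bound in [T]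
    is valid at all times. *)
Lemma head_pos_bounds t : W.+1 <= head_pos t + T /\ head_pos t <= W.+1 + T.
Proof.
have bnd u : W.+1 <= head_pos u + u /\ head_pos u <= W.+1 + u.
  elim: u => [|u [lo hi]] /=; first by rewrite addn0.
  by rewrite /head_move; case: ddelta => [[[? ?] []]|]; lia.
have [le_tT|lt_Tt] := leqP t T; first by have := bnd t; lia.
by have [_ ->] := conf_halted halted (ltnW lt_Tt); exact: bnd.
Qed.

Definition tableau (k : nat) : seq marked_cell :=
  helix (blank, false) marked_step P [seq (c, false) | c <- first_row] k.

Let mcell k i := nth (blank, false) (tableau k) i.

Lemma P_gt1 : 1 < P.
Proof. by rewrite /P; lia. Qed.

Lemma tableau_rec k i : P < i < P.+1 + k ->
  mcell k i = marked_step (mcell k i.-1) (mcell k (i - P.+1)) (mcell k (i - P))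
                          (mcell k (i - P).+1).
Proof. exact: nth_helix_rec P_gt1 size_marked_row _ _. Qed.

Lemma tableau_row k i : i <= P -> mcell k i = (cell_at (conf 0) W.+1 i, false).
Proof.
move=> le_i; rewrite /mcell /tableau (nth_helix_row _ _ size_marked_row) //.
by rewrite (nth_map blank) ?size_first_row // nth_first_row.
Qed.

(** Strong induction on [i]. Away from the borders this is the local rule; at a border, the
    neighbour borrowed from another row has no head, since [head_pos] avoids columns [0] and
    [P.-1]. *)
Lemma tableau_conf k i : i < P.+1 + k ->
  (mcell k i).1 = cell_at (conf (i %/ P)) (head_pos (i %/ P)) (i %% P).
Proof.
have P_gt0 : 0 < P by apply: ltnW P_gt1.
have bnd t : 0 < head_pos t /\ (head_pos t).+1 < P.
  by have := head_pos_bounds t; rewrite /P; lia.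
have [h] := ubnP i; elim: h i => // h IHh i; rewrite ltnS => le_h lt_i.
have [lt_iP|lt_Pi|EiP] := ltngtP i P.
- by rewrite tableau_row 1?ltnW // divn_small // modn_small.
- have IH u v : v < P -> u * P + v < i ->
      (mcell k (u * P + v)).1 = cell_at (conf u) (head_pos u) v.
    move=> lt_v lt_uv; rewrite IHh; [|by lia|by lia].
    by rewrite divnMDl // modnMDl divn_small // modn_small // addn0.
  have lt_j : i %% P < P by rewrite ltn_mod.
  have t_gt0 : 0 < i %/ P by rewrite divn_gt0 // ltnW.
  move: (i %/ P) (i %% P) (divn_eq i P) lt_j t_gt0 => [|t] // j Et lt_j _.
  rewrite tableau_rec ?lt_Pi //= -(@next_cell_at _ _ _ _
    (mcell k (i - P.+1)).1 (mcell k (i - P).+1).1) ?(bnd t).1 //.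
  + congr (next_cell _ _ _).
    by rewrite (_ : i - P = t * P + j) ?IH //; lia.
  (* In column 0 the left neighbour is the last cell of the row before the one above. *)
  + case: j lt_j Et => [|j] lt_j Et /=.
      case: t Et => [|t] Et; first by lia.
      rewrite (_ : i - P.+1 = t * P + P.-1); last by rewrite Et; lia.
      rewrite IH /cell_at /=; [|by lia|by lia].
      by case: eqP => //; have := bnd t; lia.
    rewrite eqSS (_ : i - P.+1 = t * P + j); last by rewrite Et; lia.
    rewrite IH; [|by lia|by lia].
    by case: eqP => [->|/eqP/negPf]; rewrite /cell_at //= => ->.
  (* In the last column the right neighbour is column 0 of the row being computed. *)
  + have [Ej|ne_j] := eqVneq j.+1 P.
      rewrite (_ : (i - P).+1 = t.+1 * P + 0); last by lia.
      rewrite IH; [|by lia|by lia].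
      rewrite gtn_eqF; last by have := bnd t; lia.
      by rewrite /cell_at ltn_eqF //; have := bnd t.+1; lia.
    rewrite (_ : (i - P).+1 = t * P + j.+1); last by lia.
    rewrite IH; [|by lia|by lia].
    by case: eqP => [->|/eqP/negPf]; rewrite /cell_at //= => ->.
(* Cell [P] is column 0 at time 1: the blank put there by the first row is right because the head
   starts in column [W.+1]. *)
- rewrite {}EiP in lt_i le_h *; rewrite tableau_row //= divnn P_gt0 modnn.
  rewrite -nth_first_row.
  have blank01 j : j < 2 -> cell_at (conf 0) W.+1 j = blank.
    by move=> lt_j; rewrite -nth_first_row nth_cat size_nseq nth_nseq; case: ltnP => //; lia.
  rewrite -[conf 1]/(odflt (conf 0) (dstep (conf 0))) -[head_pos 1]/(head_move (conf 0) W.+1).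
  have ne0W : 1 == W.+1 = false by apply: ltn_eqF; lia.
  rewrite -(@next_cell_at _ _ _ _ blank blank) ?ne0W // blank01 //.
  rewrite nth_first_row /cell_at /content gtn_eqF; last by rewrite /P; lia.
  rewrite ltnNge ltnW /=; last by rewrite /P; lia.
  case E: (P - W.+1) => [|i']; first by move: E; rewrite /P; lia.
  by rewrite /= nth_behead nth_default // size_map; move: E; rewrite /P; lia.
Qed.

Lemma tableau_marked k i : i < P.+1 + k -> (mcell k i).2 ->
  exists2 i', i' <= i & accepting (mcell k i').1.
Proof.
elim: i => [|i IHi] lt_i; first by rewrite tableau_row.
have [le_i|lt_Pi] := leqP i.+1 P; first by rewrite tableau_row.
rewrite {1}tableau_rec ?lt_Pi //= => /orP[/(IHi (ltnW lt_i))[i' le_i' acc]|acc].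
  by exists i' => //; apply: leqW.
by exists i.+1 => //; rewrite tableau_rec ?lt_Pi.
Qed.

Lemma tableau_mark k i i' : P < i' -> i' <= i -> i < P.+1 + k ->
  accepting (mcell k i').1 -> (mcell k i).2.
Proof.
move=> lt_Pi' /subnK<-; elim: (i - i') => [|v IHv] lt_i acc.
  by move: acc; rewrite tableau_rec ?lt_Pi' //= => ->; rewrite orbT.
rewrite tableau_rec; last by apply/andP; split; lia.
by rewrite /= IHv //; lia.
Qed.

Lemma tableau_accepts k : P * T.+2 <= k ->
  (mcell k (P + k)).2 = daccept (drun T (dinit M x)).1.
Proof.
have P_gt0 : 0 < P by apply: ltnW P_gt1.
have bnd t : 0 < head_pos t /\ (head_pos t).+1 < P.
  by have := head_pos_bounds t; rewrite /P; lia.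
move=> le_k; apply/idP/idP => [/tableau_marked|acc].
  rewrite addSn ltnS leqnn => /(_ isT)[i le_i]; rewrite tableau_conf //.
  rewrite /accepting /cell_at /=; case: eqP => // ->.
  rewrite /content ltnn subnn /=; case Ed: ddelta => //= acc.
  (* An accepting cell in any row shows a halted configuration, which must be the one at time
     [T]. *)
  have ht : dstep (conf (i %/ P)) = None by rewrite /dstep Ed.
  have [le_T|/ltnW le_T] := leqP (i %/ P) T.
    by have [E _] := conf_halted ht le_T; rewrite -/(conf T) E.
  by have [E _] := conf_halted halted le_T; rewrite -/(conf T) -E.
have lt_hP : head_pos T < P by have := bnd T; lia.
(* Row [T.+1], which repeats row [T], is used because the given cells are never marked and [T] may
   be 0. It also explains the bound [P * T.+2] on [k]. *)
apply: (@tableau_mark k _ (T.+1 * P + head_pos T)); try by have := bnd T; lia.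
rewrite tableau_conf; last by lia.
rewrite divnMDl // modnMDl divn_small // modn_small // addn0.
have [-> ->] := conf_halted halted (leqnSn T).
rewrite /accepting /cell_at eqxx /= /content ltnn subnn /= -/(conf T) acc andbT.
by move: halted; rewrite /dstep -/(conf T); case: ddelta => // -[[]].
Qed.

End Tableau.

(** * The circuit of a helix *)

Section OneHot.
Variables (A : finType) (a0 : A).

Definition one_hot (a : A) : seq bool := [seq a == y | y <- enum A].

Definition of_one_hot (v : seq bool) : A := nth a0 (enum A) (index true v).

Lemma size_one_hot a : size (one_hot a) = #|A|.
Proof. by rewrite size_map -cardE. Qed.

Lemma one_hotK a : of_one_hot (one_hot a) = a.
Proof.
rewrite /of_one_hot (_ : index true (one_hot a) = index a (enum A)).
  by rewrite nth_index ?mem_enum.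
rewrite /one_hot; elim: (enum A) => //= y s ->.
by rewrite [y == a]eq_sym eqb_id.
Qed.

End OneHot.

Section HelixCircuit.
Variables (A : finType) (a0 : A) (F : A -> A -> A -> A -> A).
Variables (w : nat) (outs : seq (A -> seq bool -> bool)).

Let K := #|A|.
Let z := shannon_size (4 * K).
Let zo := shannon_size (K + w).

Definition block_size : nat := K * z.+1.

(* The gate carrying the first bit of the [i]-th cell. *)
Definition cell_gate (i : nat) : nat := i * block_size + z.

(* From the first bit of a cell to the beginning of the next block. *)
Let gap := (K.-1 * z.+1).+1.

Let bit_refs (r : bool) (o : nat) : seq sref :=
  [seq (r, o + s * z.+1) | s <- iota 0 K].

Definition const_cell (a : A) : seq sgate := constants z (one_hot a).

Definition next_bit (s : nat) (v : seq bool) : bool :=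
  let arg i := of_one_hot a0 (take K (drop (i * K) v)) in
  nth false (one_hot (F (arg 0) (arg 1) (arg 2) (arg 3))) s.

(** For the new cell [P + 1 + i], the current position is at its predecessor [P + i] and the pointer
    at cell [i]; one and two blocks after the pointer are the other two cells above. The program
    starts [gap] gates after the current position. *)
Definition next_cell_prog : seq sgate :=
  shannons [seq next_bit s | s <- iota 0 K]
    (bit_refs false 0 ++ bit_refs true 0 ++ bit_refs true block_size ++
     bit_refs true block_size.*2) gap.

(** The only block that reads the inputs: each output is a Shannon expansion over the bits of the
    last cell and the inputs. *)
Definition output_prog : seq sgate :=
  [seq SInput j | j <- iota 0 w] ++
  shannons [seq (fun v => g (of_one_hot a0 (take K v)) (drop K v)) |
              g : A -> seq bool -> bool <- outs]
    (bit_refs false 0 ++ [seq (false, gap + j) | j <- iota 0 w]) (gap + w).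

Definition output_refs : seq sref :=
  [seq (false, gap + w + (s * zo.+1 + zo)) | s <- iota 0 (size outs)].

Definition const_gates (cs : seq A) : seq gate :=
  flatten [seq map (inst 0 0) (const_cell a) | a <- cs].

Definition next_gates (P k : nat) : seq gate :=
  flatten [seq map (inst (cell_gate (P + i)) (cell_gate i)) next_cell_prog |
             i <- iota 0 k].

Definition helix_circuit (P : nat) (row : seq A) (k : nat) : circuit :=
  Circuit (const_gates row ++ next_gates P k ++
           map (inst (cell_gate (P + k)) (cell_gate k)) output_prog)
    [seq rval (cell_gate (P + k)) (cell_gate k) r | r <- output_refs].

Lemma inst_constants cu pt cu' pt' a :
  map (inst cu pt) (const_cell a) = map (inst cu' pt') (const_cell a).
Proof.
rewrite /const_cell /constants !map_flatten -!map_comp.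
congr flatten; apply: eq_map => b /=; rewrite !map_rcons; congr rcons.
by elim: (z) => //= n ->.
Qed.

Lemma next_gatesS P k : next_gates P k.+1 =
  next_gates P k ++ map (inst (cell_gate (P + k)) (cell_gate k)) next_cell_prog.
Proof. by rewrite /next_gates -addn1 iotaD map_cat flatten_cat /= cats0. Qed.

Variable inp : seq bool.

Let K_gt0 : 0 < K.
Proof. by apply/card_gt0P; exists a0. Qed.

Definition encodes (vals : seq bool) (cs : seq A) : Prop :=
  size vals = size cs * block_size /\
  forall i s, i < size cs -> s < K ->
    nth false vals (cell_gate i + s * z.+1) = nth false (one_hot (nth a0 cs i)) s.

Lemma cell_gate_lt i s : s < K -> cell_gate i + s * z.+1 < i.+1 * block_size.
Proof.
move=> lt_s; rewrite /cell_gate mulSn /block_size.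
have : s * z.+1 + z.+1 <= K * z.+1 by rewrite -mulSnr leq_mul2r lt_s orbT.
by lia.
Qed.

Lemma encodes_rcons vals cs u a :
  encodes vals cs -> carries z u (one_hot a) -> encodes (vals ++ u) (rcons cs a).
Proof.
move=> [Ev nthv] [Eu nthu]; split.
  by rewrite size_cat Ev Eu size_one_hot size_rcons mulSnr.
move=> i s; rewrite size_rcons ltnS leq_eqVlt => /orP[/eqP->|lt_i] lt_s.
  rewrite nth_rcons ltnn eqxx -nthu ?size_one_hot //.
  rewrite nth_cat Ev /cell_gate -addnA ltnNge leq_addr /= addKn.
  by congr nth; lia.
rewrite nth_rcons lt_i -nthv // nth_cat Ev.
rewrite ifT //; apply: leq_trans (cell_gate_lt i lt_s) _.
by rewrite leq_mul2r lt_i orbT.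
Qed.

Lemma encodes_const vals cs cs' : encodes vals cs ->
  exists2 u, computes w inp vals (const_gates cs') u & encodes (vals ++ u) (cs ++ cs').
Proof.
elim: cs' vals cs => [|a cs' IH] vals cs good.
  by exists [::]; [exact: computes_nil|rewrite !cats0].
have [u C1 Cu] := computes_constants w inp 0 0 z (one_hot a) vals.
have [u' C2] := IH _ _ (encodes_rcons good Cu).
rewrite cat_rcons -catA => good'.
by exists (u ++ u') => //; apply: computes_cat C1 C2.
Qed.

Lemma encodes_nil : encodes [::] [::].
Proof. by []. Qed.

Lemma refs_values_bits cu pt vals cs (r : bool) o i :
  encodes vals cs -> i < size cs -> (if r then pt else cu) + o = cell_gate i ->
  refs_values cu pt vals (bit_refs r o) = one_hot (nth a0 cs i) /\
  all (fun q => rval cu pt q < size vals) (bit_refs r o).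
Proof.
move=> [Ev nthv] lt_i Eo; split.
  apply: (@eq_from_nth _ false); first by rewrite size_one_hot !size_map size_iota.
  move=> s; rewrite !size_map size_iota => lt_s.
  rewrite (nth_map (false, 0)) ?size_map ?size_iota //.
  by rewrite (nth_map 0) ?size_iota // nth_iota // /rval /= addnA Eo nthv.
apply/allP => q /mapP[s]; rewrite mem_iota /= add0n => lt_s ->.
rewrite /rval /= addnA Eo Ev; apply: leq_trans (cell_gate_lt i lt_s) _.
by rewrite leq_mul2r lt_i orbT.
Qed.

Lemma cell_gate_gap i : cell_gate i + gap = i.+1 * block_size.
Proof.
rewrite /cell_gate mulSn /block_size /gap addnS -addnS.
have -> : K * z.+1 = z.+1 + K.-1 * z.+1 by rewrite -mulSn prednK.
by lia.
Qed.

Lemma take_drop_nth (vss : seq (seq bool)) i :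
  all (fun v => size v == K) vss -> i < size vss ->
  take K (drop (i * K) (flatten vss)) = nth [::] vss i.
Proof.
elim: vss i => [|v vss IH] [|i] //= /andP[/eqP Ev Evss] lt_i.
  by rewrite mul0n drop0 take_size_cat.
by rewrite mulSn -Ev drop_cat Ev ltnNge leq_addr /= addKn IH.
Qed.

Lemma next_bits_values (a1 a2 a3 a4 : A) :
  [seq f (one_hot a1 ++ one_hot a2 ++ one_hot a3 ++ one_hot a4) |
     f : seq bool -> bool <- [seq next_bit s | s <- iota 0 K]] =
  one_hot (F a1 a2 a3 a4).
Proof.
rewrite -map_comp; apply: (@eq_from_nth _ false).
  by rewrite size_one_hot size_map size_iota.
move=> s; rewrite size_map size_iota => lt_s.
rewrite (nth_map 0) ?size_iota // nth_iota //= add0n /next_bit.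
have E i : i < 4 -> take K (drop (i * K)
    (one_hot a1 ++ one_hot a2 ++ one_hot a3 ++ one_hot a4)) =
    nth [::] [:: one_hot a1; one_hot a2; one_hot a3; one_hot a4] i.
  move=> lt_i; rewrite -take_drop_nth //=; first by rewrite cats0.
  by rewrite !size_one_hot eqxx.
by rewrite !E // !one_hotK.
Qed.

Lemma encodes_next P k vals cs : 1 < P -> size cs = P.+1 + k -> encodes vals cs ->
  exists2 u, computes w inp vals
      (map (inst (cell_gate (P + k)) (cell_gate k)) next_cell_prog) u &
    encodes (vals ++ u) (helix_step a0 F P cs).
Proof.
move=> P_gt1 Ecs good; have [Ev _] := good.
set cu := cell_gate (P + k); set pt := cell_gate k.
have [|E1 lt1] := @refs_values_bits cu pt vals cs false 0 (P + k) good _ (addn0 _).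
  by rewrite Ecs; lia.
have [|E2 lt2] := @refs_values_bits cu pt vals cs true 0 k good _ (addn0 _).
  by rewrite Ecs; lia.
have [||E3 lt3] := @refs_values_bits cu pt vals cs true block_size k.+1 good.
- by rewrite Ecs; lia.
- by rewrite /= /pt /cell_gate mulSn; lia.
have [||E4 lt4] := @refs_values_bits cu pt vals cs true block_size.*2 k.+2 good.
- by rewrite Ecs; lia.
- by rewrite /= /pt /cell_gate !mulSn; lia.
pose rs := bit_refs false 0 ++ bit_refs true 0 ++ bit_refs true block_size ++
  bit_refs true block_size.*2.
(* The new block begins exactly where the last cell, [P + k], ends. *)
have Esz : size vals = cu + gap by rewrite cell_gate_gap Ev Ecs.
have lt_rs : all (fun q => rval cu pt q < size vals) rs.
  by rewrite !all_cat lt1 lt2 lt3 lt4.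
have Ers : size rs = 4 * K by rewrite !size_cat !size_map !size_iota; lia.
have [u C] := computes_shannons w inp [seq next_bit s | s <- iota 0 K] Esz lt_rs.
rewrite Ers [refs_values _ _ _ _]map_cat map_cat map_cat.
rewrite -!/(refs_values cu pt vals _) E1 E2 E3 E4.
rewrite next_bits_values => Cu; exists u => //.
rewrite /helix_step Ecs.
have -> : (P.+1 + k).-1 = P + k by [].
have -> : P.+1 + k - P.+1 = k by lia.
have -> : P.+1 + k - P = k.+1 by lia.
exact: encodes_rcons.
Qed.

Lemma encodes_helix P row k : 1 < P -> size row = P.+1 ->
  exists2 u, computes w inp [::] (const_gates row ++ next_gates P k) u &
    encodes u (helix a0 F P row k).
Proof.
move=> P_gt1 Erow; elim: k => [|k [u C good]].
  by rewrite cats0; exact: (encodes_const row encodes_nil).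
have [|u' C' good'] := @encodes_next P k u _ P_gt1 _ good.
  exact: size_helix.
by exists (u ++ u'); rewrite // next_gatesS catA; apply: computes_cat C C'.
Qed.

(** The helix does not mention [inp]: its last cell acts as a parameter, the same for all inputs,
    that selects the function computed by the outputs. *)
Lemma helix_circuit_ok P row k : 1 < P -> size row = P.+1 -> size inp = w ->
  circuit_wf w (size outs) (helix_circuit P row k) /\
  circuit_eval (helix_circuit P row k) inp =
    [seq g (nth a0 (helix a0 F P row k) (P + k)) inp |
       g : A -> seq bool -> bool <- outs].
Proof.
move=> P_gt1 Erow Einp; have [u C good] := encodes_helix k P_gt1 Erow.
have Ecs := size_helix a0 F Erow k; set cs := helix a0 F P row k in good Ecs *.
have [Eu _] := good.
set cu := cell_gate (P + k); set pt := cell_gate k.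
have Esz : size u = cu + gap by rewrite cell_gate_gap Eu Ecs.
have C1 := computes_inputs inp cu pt u (leqnn w : 0 + w <= w).
have Einp' : [seq nth false inp j | j <- iota 0 w] = inp.
  by rewrite -Einp -/(mkseq _ _) mkseq_nth.
rewrite Einp' in C1.
have [|E1 lt1] := @refs_values_bits cu pt u cs false 0 (P + k) good _ (addn0 _).
  by rewrite Ecs; lia.
set rs := [seq (false, gap + j) | j <- iota 0 w].
have E2 : refs_values cu pt (u ++ inp) rs = inp.
  rewrite -[RHS]Einp' /refs_values -map_comp; apply: eq_map => j /=.
  by rewrite /rval /= addnA -Esz nth_cat ltnNge leq_addr /= addKn.
have lt2 : all (fun q => rval cu pt q < size (u ++ inp)) rs.
  apply/allP => q /mapP[j]; rewrite mem_iota /= add0n => lt_j ->.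
  by rewrite /rval /= addnA -Esz size_cat Einp ltn_add2l.
have Esz2 : size (u ++ inp) = cu + (gap + w).
  by rewrite size_cat Esz Einp addnA.
have lt12 : all (fun q => rval cu pt q < size (u ++ inp)) (bit_refs false 0 ++ rs).
  by rewrite all_cat refs_in_cat.
have [u2 C2] := computes_shannons w inp [seq (fun v => g (of_one_hot a0 (take K v)) (drop K v)) |
              g : A -> seq bool -> bool <- outs] Esz2 lt12.
rewrite size_cat !size_map !size_iota -/zo.
rewrite [refs_values _ _ _ _]map_cat -!/(refs_values cu pt (u ++ inp) _).
rewrite E2 refs_values_cat // E1.
rewrite -map_comp => -[]; rewrite size_map => Eu2 nth_u2.
have C3 := computes_cat C1 C2; rewrite -map_cat in C3.
have := computes_cat C C3; rewrite -catA; set gs := _ ++ _ => -[wf_gs run_gs].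
have Egs : size gs = size u + (w + size u2).
  have := size_run inp [::] gs; rewrite add0n => <-.
  by rewrite run_gs /= !size_cat Einp.
have Eref s : rval cu pt (false, gap + w + (s * zo.+1 + zo)) =
    size (u ++ inp) + (s * zo.+1 + zo) by rewrite Esz2 /rval /= addnA.
split; last first.
  rewrite /circuit_eval -map_comp.
  apply: (@eq_from_nth _ false); first by rewrite !size_map size_iota.
  move=> s; rewrite !size_map size_iota => lt_s.
  rewrite (nth_map (false, 0)) ?size_map ?size_iota //.
  rewrite (nth_map 0) ?size_iota // nth_iota // add0n.
  have -> : gate_vals (gates (helix_circuit P row k)) inp = u ++ inp ++ u2.
    exact: run_gs.
  rewrite [LHS]/= -/cu -/pt.
  rewrite Eref.
  rewrite catA nth_cat.
  rewrite ltnNge leq_addr /= addKn nth_u2 //.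
  rewrite (nth_map (fun _ _ => false)) // (nth_map (fun _ _ => false)) //=.
  by rewrite take_size_cat ?drop_size_cat ?size_one_hot // one_hotK.
split; first by move=> i lt_i; apply: (gates_wf_nth wf_gs lt_i).
  apply/allP => o /mapP[q /mapP[s]]; rewrite mem_iota /= add0n => lt_s -> ->.
  rewrite -/cu -/pt Eref -/gs Egs size_cat Einp -addnA ltn_add2l ltn_add2l.
  have : s.+1 * zo.+1 <= size outs * zo.+1 by rewrite leq_mul2r lt_s orbT.
  by rewrite Eu2 mulSn; lia.
by rewrite !size_map size_iota.
Qed.

End HelixCircuit.

(** * The transducer printing a helix circuit *)

(** The start [p0] is free because the first bit may already have been consumed. The final turn
    reads the right end marker, where the move to the right is clipped. *)
Lemma triple_scan (Sy : finType) K x (F : option bool -> frag Sy K) b p0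
    (cs : nat -> seq (seq Sy)) (out : nat -> seq bool) :
  p0 <= size x ->
  (forall i, p0 <= i < size x ->
    triple x (F (Some (nth false x i))) (AState i.+2 (cs i) (out i)) true
      (AState i.+2 (cs i.+1) (out i.+1))) ->
  triple x (F None) (AState (size x).+1 (cs (size x)) (out (size x))) b
    (AState (size x).+1 (cs (size x)) (out (size x))) ->
  triple x (dowhile (casef F)) (AState p0.+1 (cs p0) (out p0)) false
    (AState (size x).+1 (cs (size x)) (out (size x))).
Proof.
move=> le_p0 step last; move Ed: (size x - p0) => d.
elim: d p0 le_p0 step Ed => [|d IHd] p0 le_p0 step Ed.
  have -> : p0 = size x by lia.
  apply: triple_dowhile_last.
  have -> : false = isSome (bit_of_insym (read_input x (size x).+1)).
    by rewrite /= onth_default.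
  apply: (@triple_casef _ _ _ _ _ _ _ b) => //.
  by rewrite /= onth_default //= (minn_idPr _).
have lt_p0 : p0 < size x by lia.
have Eo : onth x p0 = Some (nth false x p0).
  by rewrite onthE (nth_map false).
apply: (@triple_dowhile_again _ _ _ _ _ (AState p0.+2 (cs p0.+1) (out p0.+1))).
  have -> : true = isSome (bit_of_insym (read_input x p0.+1)) by rewrite /= Eo.
  apply: (@triple_casef _ _ _ _ _ _ _ true); first exact: ltnW.
  by rewrite /= Eo /= (minn_idPl _) //; apply: step; rewrite leqnn.
by apply: IHd => // [i /andP[lt_i lt_ix]|]; [apply: step; rewrite ltnW|lia].
Qed.

Section Program.
Variables (A : finType) (a0 : A) (F : A -> A -> A -> A -> A).
Variables (w : nat) (outs : seq (A -> seq bool -> bool)) (N m b1 b2 : nat).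
Variables (blank_cell : A) (head_cell : option bool -> A) (bit_cell : bool -> A).
Hypotheses (b1_ok : 1 < b1 <= m.+2) (b2_ok : 1 < b2 <= m.+2).

Local Notation z := (shannon_size (4 * #|A|)).
Local Notation frag3 := (frag 'I_m.+2 3).
Local Notation registers := (@registers m).

Definition skip : frag3 := emit _ 3 None.

Definition add_counter : frag3 :=
  sweep (@add_step m 1 true false) xpredT ord_max ord0.

(** One increment before the scan and one per bit leave [n + 1] in binary; overwriting its digits by
    0 gives a loop counter of [l] cells. Starting from 1 keeps [l] positive on the empty input. *)
Definition measure_input : frag3 :=
  seqf (rewind _ 3) (seqf add_counter
    (seqf (dowhile (casef (fun o => if o is Some _ then add_counter else skip)))
       (seqf (rewind _ 3) (sweep (@reset_step m) xpredT tt ord0)))).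

Definition put_cell (a : A) : frag3 :=
  seqf (print_prog m (const_cell a)) (add_reg m false (block_size A)).

(** The first blank is printed separately: after it the current position moves by [z], to
    [cell_gate A 0], and afterwards by one block per cell. It also accounts for the [W.+1] blanks on
    the left. *)
Definition put_row : frag3 :=
  seqf (print_prog m (const_cell blank_cell))
    (seqf (add_reg m false z)
       (seqf (loop b1 (put_cell blank_cell))
          (seqf (casef (fun o => put_cell (head_cell o)))
             (seqf (dowhile (casef (fun o =>
                      if o is Some b then put_cell (bit_cell b) else skip)))
                (loop b1 (put_cell blank_cell)))))).

Definition put_next_cells : frag3 :=
  seqf (add_reg m true z)
    (loop b2 (seqf (print_prog m (next_cell_prog a0 F))
                (seqf (add_reg m false (block_size A))
                   (add_reg m true (block_size A))))).

Definition put_outputs : frag3 :=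
  seqf (print_prog m (output_prog a0 w outs))
    (seqf (puts m [:: false])
       (seqf (print_all (@print_ref m) (output_refs w outs))
          (puts m [:: false]))).

Definition program : frag3 :=
  seqf measure_input (seqf (puts m (enc_nat N))
    (seqf put_row (seqf put_next_cells put_outputs))).

Variable x : seq bool.
Let n := size x.
Let l := size (binary n.+1).
Let s0 := nseq l (digit m 0).
Let W := b1 ^ l.
Let row := nseq W.+1 blank_cell ++
  head_cell (ohead x) :: [seq bit_cell b | b <- behead x] ++ nseq W blank_cell.
Let P := (size row).-1.
Let k := b2 ^ l.
Let D := helix_circuit a0 F w outs P row k.

Local Notation triple := (triple x).

Lemma triple_add_counter p i cu pt out :
  triple add_counter (registers p (register m i) cu pt out) true
    (registers p (register m i.+1) cu pt out).
Proof.
have := @triple_sweep _ 3 x _ _ xpredT ord_max ord0 _ _ _ _ p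
  [:: register m i; register m cu; register m pt] out
  (@sweeps_add m 1 true false i ord_max).
by rewrite cats0 /= addn1 => /(_ erefl).
Qed.

Lemma triple_skip a : triple skip a true a.
Proof. by case: a => p cs out; exact: triple_emit. Qed.

Lemma triple_measure_input :
  triple measure_input (registers 0 [::] 0 0 [::]) true
    (registers 1 s0 0 0 [::]).
Proof.
apply: (@triple_seqf _ _ _ _ _ _ true); first exact: triple_rewind.
apply: (@triple_seqf _ _ _ _ _ _ true).
  exact: (@triple_add_counter 1 0).
apply: (@triple_seqf _ _ _ _ _ _ false).
  apply: (@triple_scan _ _ _ _ true 0
    (fun i => [:: register m i.+1; register m 0; register m 0])
    (fun _ => [::])) => //; last exact: triple_skip.
  by move=> i _; exact: triple_add_counter.
apply: (@triple_seqf _ _ _ _ _ _ true); first exact: triple_rewind.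
have := @triple_sweep _ 3 x _ _ xpredT tt ord0 _ _ _ _ 1
  [:: register m n.+1; register m 0; register m 0] [::]
  (sweeps_reset (register m n.+1)).
by rewrite size_map => /(_ erefl).
Qed.

Definition row_state (p : nat) (s : seq 'I_m.+2) (cs : seq A) :=
  registers p s (cell_gate A (size cs).-1) 0
    (enc_nat N ++ enc_gates (const_gates cs)).

Lemma triple_print_cell p s a cu (cs : seq A) :
  triple (print_prog m (const_cell a))
    (registers p s cu 0 (enc_nat N ++ enc_gates (const_gates cs))) true
    (registers p s cu 0 (enc_nat N ++ enc_gates (const_gates (rcons cs a)))).
Proof.
have := @triple_print_prog m x (const_cell a) p s cu 0
  (enc_nat N ++ enc_gates (const_gates cs)).
rewrite (inst_constants cu 0 0 0) -catA -enc_gates_cat.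
by rewrite /const_gates map_rcons flatten_rcons.
Qed.

Lemma triple_put_cell p s a (cs : seq A) : 0 < size cs ->
  triple (put_cell a) (row_state p s cs) true (row_state p s (rcons cs a)).
Proof.
move=> cs_gt0; apply: (@triple_seqf _ _ _ _ _ _ true).
  exact: triple_print_cell.
rewrite /row_state size_rcons.
have -> : cell_gate A (size cs).+1.-1 = cell_gate A (size cs).-1 + block_size A.
  by rewrite -{1}(prednK cs_gt0) /cell_gate mulSn; lia.
exact: triple_add_reg.
Qed.

Lemma triple_put_blanks p (cs : seq A) : 0 < size cs ->
  triple (loop b1 (put_cell blank_cell)) (row_state p s0 cs) false
    (row_state p s0 (cs ++ nseq W blank_cell)).
Proof.
move=> cs_gt0.
have -> : row_state p s0 cs = row_state p s0 (cs ++ nseq 0 blank_cell).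
  by rewrite cats0.
apply: (@triple_loop m x b1 l _ p
  (fun i => [:: register m (cell_gate A (size (cs ++ nseq i blank_cell)).-1);
                register m 0])
  (fun i => enc_nat N ++ enc_gates (const_gates (cs ++ nseq i blank_cell)))) => //.
move=> i s lt_i.
have -> : cs ++ nseq i.+1 blank_cell = rcons (cs ++ nseq i blank_cell) blank_cell.
  by rewrite -addn1 nseqD catA cats1.
by apply: (@triple_put_cell p s); rewrite size_cat ltn_addr.
Qed.

Lemma triple_put_row :
  triple put_row (registers 1 s0 0 0 (enc_nat N)) false (row_state n.+1 s0 row).
Proof.
apply: (@triple_seqf _ _ _ _ _ _ true).
  by have := @triple_print_cell 1 s0 blank_cell 0 [::]; rewrite cats0 => T; exact: T.
apply: (@triple_seqf _ _ _ _ _ _ true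
  (row_state 1 s0 [:: blank_cell])).
  exact: triple_add_reg.
apply: (@triple_seqf _ _ _ _ _ _ false
         (row_state 1 s0 (nseq W.+1 blank_cell))).
  exact: (@triple_put_blanks 1 [:: blank_cell]).
(* The part of the row printed once [i] bits have been read; the first bit lies in the head cell,
   whence [i.-1]. *)
pose pre i := nseq W.+1 blank_cell ++ head_cell (ohead x) ::
  [seq bit_cell b | b <- take i.-1 (behead x)].
have pre_gt0 i : 0 < size (pre i) by rewrite size_cat addnS.
(* The [minn 1 n] covers the empty input, on which the head stays on the right end marker. *)
apply: (@triple_seqf _ _ _ _ _ _ (isSome (bit_of_insym (read_input x 1)))
  (row_state (minn 1 n).+1 s0 (pre (minn 1 n)))).
  apply: (@triple_casef _ _ _ _ _ _ _ true) => //.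
  have -> : bit_of_insym (read_input x 1) = ohead x by case: (x).
  have -> : minn 2 n.+1 = (minn 1 n).+1 by rewrite minnSS.
  have -> : pre (minn 1 n) = rcons (nseq W.+1 blank_cell) (head_cell (ohead x)).
    by rewrite /pre -cats1; case: (n) => [|?]; rewrite /= ?minn0 ?minnSS ?min0n take0.
  by apply: triple_put_cell; rewrite size_nseq.
apply: (@triple_seqf _ _ _ _ _ _ false
  (row_state n.+1 s0 (pre n))).
  apply: (@triple_scan _ _ _ _ true (minn 1 n)
    (fun i => [:: s0; register m (cell_gate A (size (pre i)).-1); register m 0])
    (fun i => enc_nat N ++ enc_gates (const_gates (pre i)))).
  - exact: geq_minr.
  - move=> i /andP[i_gt0 lt_i].
    have {}i_gt0 : 0 < i by rewrite -/n in lt_i; lia.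
    have -> : pre i.+1 = rcons (pre i) (bit_cell (nth false x i)).
      rewrite /pre rcons_cat rcons_cons; congr (_ ++ _ :: _).
      rewrite -map_rcons -[in RHS](prednK i_gt0) -nth_behead -take_nth.
        by rewrite (prednK i_gt0).
      by rewrite size_behead -/n; rewrite -/n in lt_i; lia.
    exact: (@triple_put_cell _ s0).
  - exact: triple_skip.
have -> : row = pre n ++ nseq W blank_cell.
  rewrite /row /pre -catA cat_cons take_oversize // size_behead -/n.
  by [].
exact: triple_put_blanks.
Qed.

Lemma size_row : size row = P.+1.
Proof. by rewrite /P /row size_cat addSn. Qed.

Lemma triple_put_next_cells p :
  triple put_next_cells (row_state p s0 row) false
    (registers p s0 (cell_gate A (P + k)) (cell_gate A k)
       (enc_nat N ++ enc_gates (const_gates row ++ next_gates a0 F P k))).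
Proof.
apply: (@triple_seqf _ _ _ _ _ _ true
  (registers p s0 (cell_gate A (P + 0))
  (cell_gate A 0) (enc_nat N ++ enc_gates (const_gates row ++ next_gates a0 F P 0)))).
  rewrite cats0 addn0; exact: triple_add_reg.
apply: (@triple_loop m x b2 l _ p
  (fun i => [:: register m (cell_gate A (P + i)); register m (cell_gate A i)])
  (fun i => enc_nat N ++ enc_gates (const_gates row ++ next_gates a0 F P i))) => //.
move=> i s lt_i.
apply: (@triple_seqf _ _ _ _ _ _ true
  (registers p s (cell_gate A (P + i))
  (cell_gate A i) (enc_nat N ++ enc_gates (const_gates row ++ next_gates a0 F P i.+1)))).
  have := @triple_print_prog m x (next_cell_prog a0 F) p s (cell_gate A (P + i))
    (cell_gate A i) (enc_nat N ++ enc_gates (const_gates row ++ next_gates a0 F P i)).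
  by rewrite -catA -enc_gates_cat -catA -next_gatesS.
apply: (@triple_seqf _ _ _ _ _ _ true
  (registers p s (cell_gate A (P + i.+1))
  (cell_gate A i) (enc_nat N ++ enc_gates (const_gates row ++ next_gates a0 F P i.+1)))).
  have -> : cell_gate A (P + i.+1) = cell_gate A (P + i) + block_size A.
    by rewrite /cell_gate addnS mulSn; lia.
  exact: triple_add_reg.
have -> : [:: s, register m (cell_gate A (P + i.+1)), register m (cell_gate A i.+1) & [::]] =
    [:: s; register m (cell_gate A (P + i.+1)); register m (cell_gate A i + block_size A)].
  by congr [:: _; _; register m _]; rewrite /cell_gate mulSn; lia.
exact: triple_add_reg.
Qed.

Lemma triple_put_outputs p :
  let cu := cell_gate A (P + k) in let pt := cell_gate A k in
  triple put_outputs
    (registers p s0 cu pt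
       (enc_nat N ++ enc_gates (const_gates row ++ next_gates a0 F P k))) true
    (registers p s0 cu pt (encode N D)).
Proof.
move=> cu pt.
have -> : encode N D = (((enc_nat N ++
    enc_gates (const_gates row ++ next_gates a0 F P k)) ++
    enc_gates (map (inst cu pt) (output_prog a0 w outs))) ++
    [:: false]) ++
    flatten [seq true :: enc_nat (rval cu pt r) | r <- output_refs w outs] ++ [:: false].
  rewrite /encode /enc_seq -!/(enc_gates _) /D /helix_circuit [gates _]/= catA.
  by rewrite [outputs _]/= -map_comp !enc_gates_cat -!catA.
rewrite catA.
apply: (@triple_seqf _ _ _ _ _ _ true); first exact: triple_print_prog.
apply: (@triple_seqf _ _ _ _ _ _ true); first exact: triple_puts.
apply: (@triple_seqf _ _ _ _ _ _ true); last exact: triple_puts.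
apply: (@triple_print_all m x _ (@print_ref m) (fun r => enc_nat (rval cu pt r))).
by move=> r out; exact: triple_print_ref.
Qed.

Lemma triple_program :
  triple program (AState 0 [:: [::]; [::]; [::]] [::]) true
    (registers n.+1 s0 (cell_gate A (P + k)) (cell_gate A k) (encode N D)).
Proof.
apply: (@triple_seqf _ _ _ _ _ _ true); first exact: triple_measure_input.
apply: (@triple_seqf _ _ _ _ _ _ true); first exact: triple_puts.
apply: (@triple_seqf _ _ _ _ _ _ false); first exact: triple_put_row.
apply: (@triple_seqf _ _ _ _ _ _ false); first exact: triple_put_next_cells.
exact: triple_put_outputs.
Qed.

End Program.

(** * Hardness *)

(** Needed because the encoded graph has vertices ['I_n] instead of those of [G] or [G']; the
    inverse [g] pulls back quantified vertices and sets. *)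
Lemma sat_iso (R2 : finType) (G H : Defs.rgraph R2) (f : G -> H) :
  bijective f -> (forall r u v, Defs.arc r (f u) (f v) = Defs.arc r u v) ->
  forall m n (phi : mso R2 m n) (e : m.-tuple G) (E : n.-tuple {set G}),
  sat phi e E <-> sat phi (map_tuple f e) (map_tuple (fun A : {set G} => f @: A) E).
Proof.
move=> f_bij f_arc; have f_inj := bij_inj f_bij; have [g fK gK] := f_bij.
have cons_v m (v : G) (e : m.-tuple G) :
    map_tuple f [tuple of v :: e] = [tuple of f v :: map_tuple f e].
  exact: val_inj.
have cons_s n (A : {set G}) (E : n.-tuple {set G}) :
    map_tuple (fun A : {set G} => f @: A) [tuple of A :: E] =
    [tuple of f @: A :: map_tuple (fun A : {set G} => f @: A) E].
  exact: val_inj.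
have imgK (B : {set H}) : f @: (g @: B) = B.
  by rewrite -imset_comp (eq_imset _ gK) imset_id.
move=> m n; elim=> {m n} [m n x y|m n r x y|m n x X|m n phi IH
  |m n phi IH phi' IH'|m n phi IH phi' IH'|m n phi IH|m n phi IH|m n phi IH
  |m n phi IH] e E /=.
- by rewrite !tnth_map; split=> [->|/f_inj].
- by rewrite !tnth_map f_arc.
- by rewrite !tnth_map mem_imset.
- by rewrite IH.
- by rewrite IH IH'.
- by rewrite IH IH'.
- split=> [[v /IH]|[v]]; first by rewrite cons_v; exists (f v).
  by rewrite -(gK v) -cons_v => /IH; exists (g v).
- split=> sat_phi v; last by apply/IH; rewrite cons_v.
  by rewrite -(gK v) -cons_v; apply/IH.
- split=> [[A /IH]|[A]]; first by rewrite cons_s; exists (f @: A).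
  by rewrite -(imgK A) -cons_s => /IH; exists (g @: A).
- split=> sat_phi A; last by apply/IH; rewrite cons_s.
  by rewrite -(imgK A) -cons_s; apply/IH.
Qed.

Lemma models_iso (R2 : finType) (G H : Defs.rgraph R2) (f : G -> H) (phi : sentence R2) :
  bijective f -> (forall r u v, Defs.arc r (f u) (f v) = Defs.arc r u v) ->
  models G phi <-> models H phi.
Proof.
move=> f_bij f_arc; rewrite /models (sat_iso f_bij f_arc).
by rewrite [map_tuple f _]tuple0 [map_tuple _ _]tuple0.
Qed.

Lemma eq_bits w x y : x < 2 ^ w -> y < 2 ^ w -> bits w x = bits w y -> x = y.
Proof.
elim: w x y => [|w IHw] x y; first by rewrite expn0; lia.
rewrite !bitsS expnS => lt_x lt_y [Eo /IHw Eh].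
by have := Eh ltac:(lia) ltac:(lia); lia.
Qed.

(** With [y = 2 ^ l], this yields the exponent of the margin: [y ^ d] dominates the power of [n],
    and the factor [y ^ c.*2.+1], at least [c.*2.+2], absorbs the coefficients. *)
Lemma poly_ltn_expn c d n y : n.+1 < y -> (c * n ^ d + c).+1 < y ^ (c.*2.+1 + d).
Proof.
move=> lt_ny; rewrite expnD.
have le_nd : n ^ d <= y ^ d by case: d => // d; rewrite leq_exp2r //; lia.
have yd_gt0 : 0 < y ^ d by rewrite expn_gt0; apply/orP; left; lia.
have lt_c : c.*2.+1 < y ^ c.*2.+1.
  by apply: leq_trans (ltn_expl c.*2.+1 (isT : 1 < 2)) _; rewrite leq_exp2r //; lia.
have : c.*2.+2 * y ^ d <= y ^ c.*2.+1 * y ^ d by rewrite leq_mul2r lt_c orbT.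
apply: leq_trans.
have le1 : c * n ^ d <= c * y ^ d by rewrite leq_mul2l le_nd orbT.
have le2 : c <= c * y ^ d by rewrite leq_pmulr.
have -> : c.*2.+2 * y ^ d = c * y ^ d + c * y ^ d + y ^ d + y ^ d.
  by rewrite !mulSn -mul2n -mulnA; lia.
by lia.
Qed.

Lemma trun_halted (M : transducer) x t u :
  tstep x (trun M x t) = None -> t <= u -> trun M x u = trun M x t.
Proof.
move=> ht /subnK<-; elim: (u - t) => //= v IHv.
by rewrite -[RHS]IHv /trun /= -/(trun M x (v + t)) IHv ht.
Qed.

(** The 6 counts two blanks for each of the three tapes: the one on the left and possibly one on the
    right. *)
Lemma rep_space m (mem : memory 'I_m.+2 3) p s cu pt out :
  rep mem (registers p s cu pt out) ->
  \sum_(tp <- mtapes mem) tape_size tp <=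
  size s + size (binary cu) + size (binary pt) + 6.
Proof.
case=> _ _ hts; rewrite big_tuple.
have le_size (k : 'I_3) : tape_size (tnth (mtapes mem) k) <=
    size (nth [::] [:: s; register m cu; register m pt] k) + 2.
  have [e ->] := hts k; rewrite /tape_size /= size_cat size_map size_nseq.
  by case: e; rewrite /= ?addn0; lia.
apply: leq_trans (leq_sum _ (fun k _ => le_size k)) _.
by rewrite !big_ord_recl big_ord0 /= !size_map; lia.
Qed.

Lemma rep_memory0 (Sy : finType) :
  rep (memory0 Sy 3) (AState 0 [:: [::]; [::]; [::]] [::]).
Proof.
split=> //= k; exists false.
by rewrite tnth_mktuple; case: k => [[|[|[|]]]].
Qed.

(** * The reduction and its space bound *)

Section Reduction.
Variables (A : finType) (a0 : A) (F : A -> A -> A -> A -> A).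
Variables (w : nat) (outs : seq (A -> seq bool -> bool)) (N e1 e2 : nat).
Variables (blank_cell : A) (head_cell : option bool -> A) (bit_cell : bool -> A).

Definition input_width (x : seq bool) : nat := size (binary (size x).+1).

Definition margin (x : seq bool) : nat := (2 ^ e1) ^ input_width x.

Definition initial_row (x : seq bool) : seq A :=
  nseq (margin x).+1 blank_cell ++
  head_cell (ohead x) :: [seq bit_cell b | b <- behead x] ++
  nseq (margin x) blank_cell.

Definition row_length (x : seq bool) : nat := (size (initial_row x)).-1.

Definition num_steps (x : seq bool) : nat := (2 ^ e2) ^ input_width x.

Definition reduction (x : seq bool) : seq bool :=
  encode N (helix_circuit a0 F w outs (row_length x) (initial_row x) (num_steps x)).

Lemma row_lengthE x : row_length x = margin x + (margin x).+1 + (size x).-1.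
Proof.
rewrite /row_length /initial_row size_cat /= size_cat !size_nseq size_map.
by rewrite size_behead; lia.
Qed.

Lemma size_lt_width x : (size x).+1 < 2 ^ input_width x.
Proof. exact: ltn_size_binary. Qed.

Lemma input_width_leq x : input_width x <= trunc_log 2 (size x) + 2.
Proof.
apply: size_binary_leq; rewrite addn2 expnS.
by have := trunc_log_ltn (size x) (isT : 1 < 2); lia.
Qed.

Lemma size_cell_gate_leq x i : i <= row_length x + num_steps x ->
  size (binary (cell_gate A i)) <=
  input_width x * (e1 + e2).+1 + (2 + block_size A + shannon_size (4 * #|A|)).
Proof.
move=> le_i; apply: size_binary_leq; rewrite /cell_gate.
set B := block_size A; set z := shannon_size _; set l := input_width x.
have le_exp j : j <= (e1 + e2).+1 -> 2 ^ (l * j) <= 2 ^ (l * (e1 + e2).+1).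
  by move=> le_j; rewrite leq_exp2l // leq_mul2l le_j orbT.
have := le_exp e1 (leqW (leq_addr _ _)); have := le_exp e2 (leqW (leq_addl _ _)).
have := le_exp 1 isT.
have := size_lt_width x; rewrite -/l muln1.
set X := 2 ^ (l * (e1 + e2).+1) => lt_x le1 le2 le3.
(* The two margins, the number of steps and the input length are each at most [X]; this 4 is the
   summand 2 in the exponent. *)
have {}le_i : i <= 4 * X.
  apply: leq_trans le_i _; rewrite row_lengthE /margin /num_steps -/l -!expnM.
  by rewrite ![_ * l]mulnC; lia.
have lt_Bz : B + z < 2 ^ (B + z) by apply: ltn_expl.
rewrite expnD -addnA expnD -/X -[2 ^ 2]/4.
have X_gt0 : 0 < X by rewrite expn_gt0.
have le_iB : i * B <= 4 * X * B by rewrite leq_mul2r le_i orbT.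
have le_z : z <= 4 * X * z by rewrite leq_pmull // muln_gt0.
have : 4 * X * (B + z) < 4 * X * 2 ^ (B + z).
  by rewrite ltn_pmul2l // muln_gt0.
by rewrite mulnDr mulnA [X * 4]mulnC; lia.
Qed.

Lemma logspace_reduction : 0 < e1 -> 0 < e2 -> logspace reduction.
Proof.
move=> e1_gt0 e2_gt0.
have pow_ok e : 0 < e -> e <= e1 + e2 -> 1 < 2 ^ e <= (2 ^ (e1 + e2)).+2.
  move=> e_gt0 le_e; apply/andP; split; first by rewrite -{1}(expn0 2) ltn_exp2l.
  by rewrite !leqW // leq_exp2l.
(* Large enough for the digits of both bases, [2 ^ e1] and [2 ^ e2]. *)
pose m := 2 ^ (e1 + e2).
pose T := program a0 F w outs N m (2 ^ e1) (2 ^ e2) blank_cell head_cell bit_cell.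
pose Q := 2 + block_size A + shannon_size (4 * #|A|).
exists (transducer_of T), (4 * (e1 + e2).+1 + 2 * Q + 10) => x.
have [mem ex rmem] : exists2 mem, exec x T (memory0 _ 3) true mem &
    rep mem (registers (size x).+1 (nseq (input_width x) (digit m 0))
      (cell_gate A (row_length x + num_steps x)) (cell_gate A (num_steps x))
      (reduction x)).
  apply: triple_program (rep_memory0 _); first exact: pow_ok (leq_addr _ _).
  exact: pow_ok (leq_addl _ _).
have [t [ht Eout Ework]] := exec_transducer ex.
split; first by exists t; rewrite Eout; case: rmem.
move=> u.
(* Space grows until time [t] and is constant afterwards, so it suffices to bound it at time [t]. *)
apply: (@leq_trans (\sum_(tp <- tcwork (trun (transducer_of T) x t)) tape_size tp)).
  have [le_ut|/ltnW le_tu] := leqP u t; first exact: leq_sum_work.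
  by rewrite (trun_halted ht le_tu).
rewrite Ework; apply: leq_trans (rep_space rmem) _; rewrite size_nseq.
have := input_width_leq x.
have := size_cell_gate_leq (leqnn (row_length x + num_steps x)).
have := size_cell_gate_leq (leq_addl (row_length x) (num_steps x)).
rewrite -/Q; move: (size (binary _)) (size (binary _)) => c1 c2.
move: (input_width x) (trunc_log _ _) => l h le1 le2 le_l.
have := leq_mul le_l (leqnn (e1 + e2).+1).
move: le1 le2; move: (e1 + e2).+1 Q => E Q' le1 le2.
by nia.
Qed.

End Reduction.

Lemma card_ord_bij (T : finType) n : #|T| = n -> exists f : 'I_n -> T, bijective f.
Proof.
move=> ET; exists (fun i => enum_val (cast_ord (esym ET) i)).
apply: bij_comp; first exact: enum_val_bij.
by exists (cast_ord ET); [exact: cast_ordKV|exact: cast_ordK].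
Qed.

Lemma initial_row_tableau (M : decider) e (x : seq bool) :
  initial_row e (blank M, false)
    (fun o => ((Some (dstart M), omap inl o), false))
    (fun b => ((None, Some (inl b)), false)) x =
  [seq (c, false) | c <- first_row M x (margin e x)].
Proof.
by rewrite /first_row map_cat map_nseq /= map_cat map_nseq -map_comp.
Qed.

Theorem theorem3 (R2 : finType) (psi chi : sentence R2) :
  cw_size_independent psi chi -> P_hard (under_dynamics psi chi).
Proof.
(* The lower bound 1 on [n] provides the nonempty vertex set required by [succinct_rep]. *)
move=> [cw /(_ 1)[n n_gt0 [G [G' [[EG EG' _ _] [psiG chiG psiG' chiG']]]]]].
move=> L [M [c [d decides]]].
pose w := up_log 2 n.
have [f f_bij] := card_ord_bij EG; have [f' f'_bij] := card_ord_bij EG'.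
(* Inverse of [bits w] on vertices; the default only serves bit patterns that number no vertex. *)
pose lookup (v : seq bool) : 'I_n := odflt (Ordinal n_gt0) [pick i : 'I_n | bits w i == v].
have lookupK (i : 'I_n) : lookup (bits w i) = i.
  have lt_w (j : 'I_n) : j < 2 ^ w by apply: leq_trans (up_logP _ _).
  rewrite /lookup; case: pickP => [j /eqP/eq_bits Ej|/(_ i)]; last by rewrite eqxx.
  by apply: val_inj; apply: Ej.
pose A : finType := ((option (dstate M) * option (bool + dsym M)) * bool)%type.
pose out r (a : A) v := let u := lookup (take w v) in let u' := lookup (drop w v) in
  if a.2 then Defs.arc r (f u) (f u') else Defs.arc r (f' u) (f' u').
pose outs := [seq out r | r <- enum R2].
(* [e1] makes the margin [W] exceed the running time, and [e2] makes the number of steps equal to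
   [2 ^ (l * 2)] times [W * W], enough for all the rows needed. *)
pose e1 := c.*2.+1 + d; pose e2 := e1.*2.+2.
exists (@reduction A (blank M, false) (@marked_step M) (2 * w) outs n e1 e2
  (blank M, false) (fun o => ((Some (dstart M), omap inl o), false))
  (fun b => ((None, Some (inl b)), false))).
  exact: logspace_reduction.
move=> x; have [halted accepts] := decides x.
set T := c * size x ^ d + c in halted accepts.
pose W := margin e1 x; pose k := num_steps e2 x.
pose P := W + W.+1 + (size x).-1.
have lt_width := size_lt_width x.
have lt_TW : T.+1 < W.
  by rewrite /W /margin -expnM mulnC expnM; apply: poly_ltn_expn.
have le_k : P * T.+2 <= k.
  have -> : k = 2 ^ (input_width x * 2) * (W * W).
    rewrite /k /num_steps /W /margin -!expnM -!expnD; congr (_ ^ _).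
    by rewrite /e2 -muln2; lia.
  have le_width : 2 ^ input_width x <= W.
    by rewrite /W /margin -expnM leq_exp2l // leq_pmull.
  have lt1 : 1 < 2 ^ input_width x by apply: leq_ltn_trans lt_width.
  have le4 : 4 <= 2 ^ (input_width x * 2) by rewrite expnM (@leq_exp2r 2 _ 2).
  (* It remains to see that [P] is at most [4 * W] and [T.+2] at most [W]. *)
  apply: leq_trans (leq_mul le4 (leqnn _)).
  rewrite mulnA; apply: leq_mul; last exact: lt_TW.
  by rewrite /P; lia.
rewrite /reduction row_lengthE (initial_row_tableau M e1 x) -/W -/P -/k.
set D := helix_circuit _ _ _ _ _ _ _.
have ok inp := @helix_circuit_ok A (blank M, false) (@marked_step M) (2 * w) outs
  inp P _ k (P_gt1 x lt_TW) (size_marked_row M x W).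
have acc := tableau_accepts halted lt_TW le_k.
have {}acc : (nth (blank M, false) (tableau M x W k) (P + k)).2 <-> L x.
  by rewrite acc.
pose a := nth (blank M, false) (tableau M x W k) (P + k).
(* The mark of [a] is fixed by [x], so the circuit describes all arcs of [G] or all arcs of [G']. *)
have arcE r (u v : encoded_graph R2 n D) : Defs.arc r u v =
    if a.2 then Defs.arc r (f u) (f v) else Defs.arc r (f' u) (f' v).
  rewrite /=.
  have [|_ ->] := ok (bits w u ++ bits w v).
    by rewrite size_cat !size_mkseq mul2n addnn.
  rewrite -map_comp (nth_map r) ?nth_enum_rank ?cardE //=; last by rewrite -cardE ltn_ord.
  by rewrite /out take_size_cat ?drop_size_cat ?size_mkseq // !lookupK.
have rep : succinct_rep R2 n D.
  split=> //; have [|wf _] := ok (nseq (2 * w) false); first by rewrite size_nseq.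
  by move: wf; rewrite size_map -cardE.
split=> [Lx|nLx]; exists n, D; split=> //.
- have Ea : a.2 by apply/acc.
  apply/(@models_iso R2 (encoded_graph R2 n D) G f chi f_bij) => // r u v.
  by rewrite arcE Ea.
- have Ea : a.2 by apply/acc.
  apply/(@models_iso R2 (encoded_graph R2 n D) G f psi f_bij) => // r u v.
  by rewrite arcE Ea.
- have Ea : a.2 = false by apply/negP => /acc.
  apply/(@models_iso R2 (encoded_graph R2 n D) G' f' chi f'_bij) => // r u v.
  by rewrite arcE Ea.
- have Ea : a.2 = false by apply/negP => /acc.
  move=> psi_enc; apply: psiG'.
  apply/(@models_iso R2 (encoded_graph R2 n D) G' f' psi f'_bij) => // r u v.
  by rewrite arcE Ea.
Qed.
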